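(* Let $\mathcal{G}=(\mathcal{N},\mathcal{E})$ be a connected undirected graph, $\mathcal{N}=\{1,\dots,N\}$, let $f_i:\mathbf{R}^{n_i}\to\mathbf{R}\cup\{+\infty\}$ be convex, closed, and proper, $A_i\in\mathbf{R}^{m\times n_i}$, $b_i\in\mathbf{R}^m$ for all $i\in\mathcal{N}$, and let $\mathcal{K}\subseteq\mathbf{R}^m$ be a nonempty, closed, and convex cone. Consider the primal problem $$(\mathcal{P})\qquad \text{minimize over } x=(x_i)_{i\in\mathcal{N}}\quad \sum_{i\in\mathcal{N}} f_i(x_i)\quad\text{subject to}\quad \sum_{i\in\mathcal{N}}(A_ix_i-b_i)\in\mathcal{K},$$ and its dual $$(\mathcal{D})\qquad \text{maximize over } y\in\mathbf{R}^m\quad -\sum_{i\in\mathcal{N}}\big(f_i^*(-A_i^*y)+\langle y,b_i\rangle+\mathcal{I}_{\mathcal{K}^\circ}(y)\big).$$ Assume that a primal-dual solution exists and the duality gap is zero (i.e. $(\mathcal{P})$ has a minimizer, $(\mathcal{D})$ has a maximizer, and their optimal values are equal). Let $\sigma>0$, $\rho>0$, let $y_i^0,z_i^0,s_i^0\in\mathbf{R}^m$ be arbitrary and $p_i^0=0$ for all $i\in\mathcal{N}$, and let the sequences $p_i^k,s_i^k,r_i^k,x_i^k,y_i^k,z_i^k$ be generated, for $k=0,1,2,\dots$ and all $i\in\mathcal{N}$, by $$\begin{aligned} p_i^{k+1}&=p_i^k+\rho\sum_{j\in\mathcal{N}_i}(y_i^k-y_j^k),\\ s_i^{k+1}&=s_i^k+\sigma(y_i^k-z_i^k),\\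 r_i^{k+1}&=\sigma z_i^k+\rho\sum_{j\in\mathcal{N}_i}(y_i^k+y_j^k)-(b_i+p_i^{k+1}+s_i^{k+1}),\\ x_i^{k+1}&\in\operatorname*{argmin}_{x_i}\Big\{f_i(x_i)+\tfrac{1}{2(\sigma+2\rho d_i)}\|A_ix_i+r_i^{k+1}\|^2\Big\},\\ y_i^{k+1}&=\tfrac{1}{\sigma+2\rho d_i}\big(A_ix_i^{k+1}+r_i^{k+1}\big),\\ z_i^{k+1}&=\Pi_{\mathcal{K}^\circ}\big(y_i^{k+1}+\tfrac1\sigma s_i^{k+1}\big). \end{aligned}$$ Then there is a maximizer $y^\star$ of $(\mathcal{D})$ such that for all $i\in\mathcal{N}$ the sequences $\{y_i^k\}_{k\in\mathbf{N}}$ and $\{z_i^k\}_{k\in\mathbf{N}}$ both converge to $y^\star$. Moreover, any limit point of the sequence $\{(x_i^k)_{i\in\mathcal{N}}\}_{k\in\mathbf{N}}$ is a minimizer of $(\mathcal{P})$.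
   Context: Each $\mathbf{R}^n$ carries an inner product $\langle\cdot,\cdot\rangle$ with induced norm $\|\cdot\|$; $A^*$ is the adjoint of a linear operator $A$. $(x_i)_{i\in\mathcal{N}}$ is the vertical concatenation of the vectors $x_i$. The graph being undirected means $(i,j)\in\mathcal{E}$ implies $(j,i)\in\mathcal{E}$; $\mathcal{N}_i=\{j\in\mathcal{N}\mid (i,j)\in\mathcal{E}\}$ and $d_i=|\mathcal{N}_i|$. $f^*(y)=\sup_x\{\langle y,x\rangle-f(x)\}$ is the conjugate of $f$; $\mathcal{I}_{\mathcal{C}}$ is the indicator function of a set $\mathcal{C}$ (value $0$ on $\mathcal{C}$, $+\infty$ elsewhere); $\Pi_{\mathcal{C}}$ is the projection onto the nonempty closed convex set $\mathcal{C}$; $\mathcal{K}^\circ=\{y\mid \sup_{x\in\mathcal{K}}\langle x,y\rangle\le 0\}$ is the polar cone of $\mathcal{K}$. In the $x_i$-update, which need not have a unique minimizer, an arbitrary minimizer may be chosen. *)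

(* Defs.v *)
From HB Require Import structures.
From mathcomp Require Import all_boot all_order all_algebra.
From mathcomp Require Import sesquilinear.
From mathcomp Require Import all_classical all_reals all_analysis.

Set Implicit Arguments.
Unset Strict Implicit.
Unset Printing Implicit Defensive.

Import Order.TTheory GRing.Theory Num.Theory.
Import numFieldNormedType.Exports.

Local Open Scope classical_set_scope.
Local Open Scope ring_scope.

(* An inner product on R^d is an arbitrary symmetric positive definite bilinear
   form, [{dot 'cV[R]_d for idfun}].  Closed sets, convergence and limit points
   refer to the normed topology of 'cV[R]_d (sup norm), which is the one induced
   by any inner product. *)

Definition ipnorm (R : realType) (d : nat) (dot : {dot 'cV[R]_d for idfun})
  (u : 'cV[R]_d) : R := Num.sqrt (dot u u).

Definition is_adjoint (R : realType) (m n : nat)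
    (dotm : {dot 'cV[R]_m for idfun}) (dotn : {dot 'cV[R]_n for idfun})
    (A : 'M[R]_(m, n)) (B : 'M[R]_(n, m)) : Prop :=
  forall (x : 'cV[R]_n) (y : 'cV[R]_m), dotm (A *m x) y = dotn x (B *m y).

(* [adjointP] and [adjoint_uniq] below: this is the adjoint of A. *)
Definition adjoint (R : realType) (m n : nat)
    (dotm : {dot 'cV[R]_m for idfun}) (dotn : {dot 'cV[R]_n for idfun})
    (A : 'M[R]_(m, n)) : 'M[R]_(n, m) :=
  get [set B | is_adjoint dotm dotn A B].

Definition gram (R : realType) (d : nat) (dot : {dot 'cV[R]_d for idfun}) :
  'M[R]_d := \matrix_(i, j) dot (delta_mx i 0) (delta_mx j 0).

Lemma dot_gram (R : realType) (d : nat) (dot : {dot 'cV[R]_d for idfun})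
  (u v : 'cV[R]_d) : dot u v = (u^T *m gram dot *m v) 0 0.
Proof.
have E (w : 'cV[R]_d) : w = \sum_i w i 0 *: delta_mx i 0.
  rewrite [LHS]matrix_sum_delta; apply: eq_bigr => i _.
  by rewrite big_ord_recl big_ord0 addr0.
rewrite [in LHS](E v) linear_sumr mxE; apply: eq_bigr => j _.
rewrite linearZr_LR /= mulrC; congr (_ * _).
rewrite [in LHS](E u) linear_sumlz mxE; apply: eq_bigr => i _.
by rewrite linearZl_LR /= !mxE.
Qed.

Lemma gram_unit (R : realType) (d : nat) (dot : {dot 'cV[R]_d for idfun}) :
  gram dot \in unitmx.
Proof.
rewrite -unitmx_tr -row_free_unit; apply/inj_row_free => v /(congr1 trmx).
rewrite trmx_mul trmxK trmx0 => Gv; apply: trmx_inj; rewrite trmx0.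
apply/eqP; apply: contraT => /(@neq0_dnorm_gt0 _ _ _ dot).
by rewrite dot_gram -mulmxA Gv mulmx0 mxE ltxx.
Qed.

Lemma adjoint_uniq (R : realType) (m n : nat)
    (dotm : {dot 'cV[R]_m for idfun}) (dotn : {dot 'cV[R]_n for idfun})
    (A : 'M[R]_(m, n)) (B C : 'M[R]_(n, m)) :
  is_adjoint dotm dotn A B -> is_adjoint dotm dotn A C -> B = C.
Proof.
move=> hB hC; apply/eqP; rewrite -subr_eq0; apply/eqP/matrixP => i j.
have : (B - C) *m delta_mx j (0 : 'I_1) = 0.
  set u := _ *m _; apply/eqP; apply: contraT.
  move=> /(@neq0_dnorm_gt0 _ _ _ dotn).
  have -> : dotn u u = dotn u (B *m delta_mx j 0) - dotn u (C *m delta_mx j 0).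
    by rewrite -linearBr -mulmxBl.
  by rewrite -hB -hC subrr ltxx.
by rewrite -colE => /colP/(_ i); rewrite mxE => ->; rewrite !mxE.
Qed.

Lemma adjointP (R : realType) (m n : nat)
    (dotm : {dot 'cV[R]_m for idfun}) (dotn : {dot 'cV[R]_n for idfun})
    (A : 'M[R]_(m, n)) : is_adjoint dotm dotn A (adjoint dotm dotn A).
Proof.
apply: (@getPex _ [set B | is_adjoint dotm dotn A B]).
exists (invmx (gram dotn) *m A^T *m gram dotm) => x y.
rewrite !dot_gram trmx_mul -!mulmxA; congr ((_ *m _) 0 0).
by rewrite mulKVmx ?gram_unit.
Qed.

Definition cone (R : realType) (d : nat) (K : set 'cV[R]_d) : Prop :=
  forall (t : R) (x : 'cV[R]_d), 0 < t -> K x -> K (t *: x).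

Definition polar (R : realType) (d : nat) (dot : {dot 'cV[R]_d for idfun})
    (K : set 'cV[R]_d) : set 'cV[R]_d :=
  [set y | (ereal_sup [set (dot x y)%:E | x in K] <= 0)%E].

Definition indicator (R : realType) (d : nat) (C : set 'cV[R]_d)
  (y : 'cV[R]_d) : \bar R := if y \in C then 0%E else +oo%E.

(* Functions R^d -> R u {+oo} have codomain \bar R; the value -oo is excluded by
   [proper_fun].  In \bar R, 0 * +oo = 0. *)
Definition convex_efun (R : realType) (d : nat) (f : 'cV[R]_d -> \bar R) :
    Prop :=
  forall (x y : 'cV[R]_d) (t : R), 0 <= t <= 1 ->
    (f (t *: x + (1 - t) *: y)%R <= t%:E * f x + (1 - t)%:E * f y)%E.

Definition closed_fun (R : realType) (d : nat) (f : 'cV[R]_d -> \bar R) :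
    Prop :=
  closed [set p : 'cV[R]_d * R | (f p.1 <= p.2%:E)%E].

Definition proper_fun (R : realType) (d : nat) (f : 'cV[R]_d -> \bar R) :
    Prop :=
  (forall x, (-oo < f x)%E) /\ (exists x, (f x < +oo)%E).

Definition conjugate (R : realType) (d : nat)
    (dot : {dot 'cV[R]_d for idfun}) (f : 'cV[R]_d -> \bar R)
    (y : 'cV[R]_d) : \bar R :=
  ereal_sup (range (fun x => (dot y x)%:E - f x)%E).

Definition is_minimizer (R : realType) (T : Type) (C : set T) (F : T -> \bar R)
  (x : T) : Prop := C x /\ forall w, C w -> (F x <= F w)%E.

Definition is_maximizer (R : realType) (T : Type) (C : set T) (F : T -> \bar R)
  (x : T) : Prop := C x /\ forall w, C w -> (F w <= F x)%E.

Definition is_proj (R : realType) (d : nat) (dot : {dot 'cV[R]_d for idfun})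
    (C : set 'cV[R]_d) (v z : 'cV[R]_d) : Prop :=
  is_minimizer C (fun u => (ipnorm dot (u - v))%:E) z.

Definition nbrs (N : nat) (E : rel 'I_N) (i : 'I_N) : {set 'I_N} :=
  [set j | E i j].

Definition deg (N : nat) (E : rel 'I_N) (i : 'I_N) : nat := #|nbrs E i|.

(* The primal variable is the stacked vector x, with blocks submxcol x i. *)
Definition primal_obj (R : realType) (N : nat) (n : 'I_N -> nat)
    (f : forall i, 'cV[R]_(n i) -> \bar R) (x : 'cV[R]_(\sum_i n i)) : \bar R :=
  (\sum_(i < N) f i (submxcol x i))%E.

Definition primal_feasible (R : realType) (N m : nat) (n : 'I_N -> nat)
    (A : forall i, 'M[R]_(m, n i)) (b : 'I_N -> 'cV[R]_m) (K : set 'cV[R]_m) :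
    set 'cV[R]_(\sum_i n i) :=
  [set x | K (\sum_(i < N) (A i *m submxcol x i - b i))].

Definition dual_obj (R : realType) (N m : nat) (n : 'I_N -> nat)
    (dot : forall d, {dot 'cV[R]_d for idfun})
    (f : forall i, 'cV[R]_(n i) -> \bar R)
    (A : forall i, 'M[R]_(m, n i)) (b : 'I_N -> 'cV[R]_m) (K : set 'cV[R]_m)
    (y : 'cV[R]_m) : \bar R :=
  (- \sum_(i < N) (conjugate (dot (n i)) (f i)
                     (- (adjoint (dot m) (dot (n i)) (A i) *m y))%R
                   + (dot m y (b i))%:E
                   + indicator (polar (dot m) K) y))%E.

Definition primal_value (R : realType) (N m : nat) (n : 'I_N -> nat)
    (f : forall i, 'cV[R]_(n i) -> \bar R)
    (A : forall i, 'M[R]_(m, n i)) (b : 'I_N -> 'cV[R]_m) (K : set 'cV[R]_m) :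
    \bar R :=
  ereal_inf (primal_obj f @` primal_feasible A b K).

Definition dual_value (R : realType) (N m : nat) (n : 'I_N -> nat)
    (dot : forall d, {dot 'cV[R]_d for idfun})
    (f : forall i, 'cV[R]_(n i) -> \bar R)
    (A : forall i, 'M[R]_(m, n i)) (b : 'I_N -> 'cV[R]_m) (K : set 'cV[R]_m) :
    \bar R :=
  ereal_sup (range (dual_obj dot f A b K)).

(* Main.v *)
(* Put lam_ij^k for the sum over l < k of y_i^l - y_j^l, so that p_i = rho sum_j lam_ij.
   The updates say that - A_i^T y_i (T for the adjoint) is a subgradient of f_i at x_i, that s_i is
   normal to the polar cone at z_i, and express A_i x_i - b_i through lam, s, y and z.
   For a reference point (y', s', lam') satisfying the optimality conditions, the
   monotonicity of these two operators makes
     sum_i (|s_i - s'_i|^2 / sigma + sigma |z_i - y'|^2)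
     + rho/2 sum_{(i,j) in E} (|lam_ij - lam'_ij|^2 + |y_i + y_j - 2 y'|^2)
   nonincreasing, with a decrease that controls the successive differences.
   A primal-dual solution gives a first reference point: s' splits the residual
   equally among the nodes and lam' is a flow on the connected graph carrying the
   imbalance.  Hence the sequences are bounded.  Their limits along an ultrafilter
   finer than \oo form a second reference point, for which the function tends to 0
   along the ultrafilter, hence, being monotone, along \oo.  The x_i^k themselves
   need not converge or be bounded, only the A_i x_i^k are, so a reference point
   only involves vectors replacing A_i x_i - b_i. *)

Require Import Defs.
From HB Require Import structures.
From mathcomp Require Import all_boot all_order all_algebra.
From mathcomp Require Import sesquilinear.
From mathcomp Require Import all_classical all_reals all_analysis.
From mathcomp Require Import lra.

Set Implicit Arguments.
Unset Strict Implicit.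
Unset Printing Implicit Defensive.

Import Order.TTheory GRing.Theory Num.Theory.
Import numFieldNormedType.Exports.

Local Open Scope classical_set_scope.
Local Open Scope ring_scope.

(** * Inner products and limits *)

Section Dot.
Variables (R : realType) (d : nat) (D : {dot 'cV[R]_d for idfun}).
Implicit Types u v w : 'cV[R]_d.

Lemma dotC u v : D u v = D v u.
Proof. by rewrite hermC expr0 mul1r. Qed.

Lemma dotDl u v w : D (u + v) w = D u w + D v w.
Proof. exact: linearDl. Qed.

Lemma dotBl u v w : D (u - v) w = D u w - D v w.
Proof. exact: linearBl. Qed.

Lemma dotNl u w : D (- u) w = - D u w.
Proof. exact: linearNl. Qed.

Lemma dotZl a u w : D (a *: u) w = a * D u w.
Proof. exact: linearZl_LR. Qed.

Lemma dot0l w : D 0 w = 0.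
Proof. exact: linear0l. Qed.

Lemma dotDr u v w : D w (u + v) = D w u + D w v.
Proof. exact: linearDr. Qed.

Lemma dotBr u v w : D w (u - v) = D w u - D w v.
Proof. exact: linearBr. Qed.

Lemma dotNr u w : D w (- u) = - D w u.
Proof. exact: linearNr. Qed.

Lemma dotZr a u w : D w (a *: u) = a * D w u.
Proof. exact: linearZr_LR. Qed.

Lemma dot0r w : D w 0 = 0.
Proof. exact: linear0r. Qed.

Lemma dot_sumr I (r : seq I) (P : pred I) (F : I -> 'cV[R]_d) w :
  D w (\sum_(i <- r | P i) F i) = \sum_(i <- r | P i) D w (F i).
Proof. exact: linear_sumr. Qed.

Definition dotE := (dotDl, dotDr, dotNl, dotNr, dotZl, dotZr).

Lemma dot_ge0 u : 0 <= D u u.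
Proof.
have [->|/(@neq0_dnorm_gt0 _ _ _ D)/ltW//] := eqVneq u 0.
by rewrite dot0l.
Qed.

Lemma dot_eq0 u : D u u = 0 -> u = 0.
Proof.
move=> u0; apply/eqP; apply: contraT => /(@neq0_dnorm_gt0 _ _ _ D).
by rewrite u0 ltxx.
Qed.

Lemma dot_cauchy_schwarz u v : D u v ^+ 2 <= D u u * D v v.
Proof.
have [->|/(@neq0_dnorm_gt0 _ _ _ D) v0] := eqVneq v 0.
  by rewrite !dot0r expr0n mulr0.
have := dot_ge0 (D v v *: u - D u v *: v).
rewrite !dotE (dotC v u) => h.
rewrite -subr_ge0 -(pmulr_rge0 _ v0); apply: le_trans h _.
by rewrite le_eqVlt; apply/orP; left; apply/eqP; lra.
Qed.

Lemma dot_subl_self u v :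
  2 * D (u - v) u = D u u - D v v + D (u - v) (u - v).
Proof. by rewrite !dotE (dotC v u); lra. Qed.

(** Riesz representation of a coordinate, by invertibility of the Gram matrix. *)
Lemma coord_dot u j :
  u j 0 = D u (invmx (gram D) *m delta_mx j 0).
Proof.
rewrite dot_gram -!mulmxA mulKVmx ?gram_unit // -colE !mxE; congr (u _ _).
Qed.

(** Half of the equivalence of norms, by Cauchy-Schwarz: boundedness and convergence in any inner
    product can be read on coordinates. *)
Lemma coord_le_dot j : exists2 C, 0 <= C & forall u, u j 0 ^+ 2 <= C * D u u.
Proof.
pose g := invmx (gram D) *m delta_mx j 0 : 'cV_d.
exists (D g g) => [|u]; first exact: dot_ge0.
by rewrite coord_dot mulrC dot_cauchy_schwarz.
Qed.

End Dot.

Section Convergence.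
Context {R : realType} {T : Type} {F : set_system T} {FF : Filter F}.

Lemma cvg_sum_seq (V : normedModType R) I (r : seq I) (P : pred I)
    (f : I -> T -> V) (l : I -> V) :
    (forall i, P i -> f i x @[x --> F] --> l i) ->
  (\sum_(i <- r | P i) f i x) @[x --> F] --> \sum_(i <- r | P i) l i.
Proof.
move=> fl; apply: cvg_big => //; exact: add_continuous.
Qed.

Lemma cvg_sum_seq0 I (r : seq I) (P : pred I) (f : I -> T -> R) :
    (forall i, P i -> f i x @[x --> F] --> (0 : R)) ->
  (\sum_(i <- r | P i) f i x) @[x --> F] --> (0 : R).
Proof.
move=> f0.
have : (\sum_(i <- r | P i) f i x) @[x --> F] --> \sum_(i <- r | P i) (0 : R).
  exact: cvg_sum_seq.
by rewrite big1.
Qed.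

Lemma cvg_cV (d : nat) (u : T -> 'cV[R]_d) (l : 'cV[R]_d) :
  (forall j, u x j 0 @[x --> F] --> l j 0) -> u x @[x --> F] --> l.
Proof.
have E (w : 'cV[R]_d) : w = \sum_i w i 0 *: delta_mx i 0.
  rewrite [LHS]matrix_sum_delta; apply: eq_bigr => i _.
  by rewrite big_ord_recl big_ord0 addr0.
move=> ul; rewrite (E l); under eq_fun => x do rewrite (E (u x)).
apply: cvg_sum_seq => i _; apply: cvgZr_tmp; exact: ul.
Qed.

Lemma cvg_coord (p q : nat) (u : T -> 'M[R]_(p, q)) (l : 'M[R]_(p, q)) i j :
  u x @[x --> F] --> l -> u x i j @[x --> F] --> l i j.
Proof.
move=> ul; apply: (cvg_comp u (fun M : 'M[R]_(p, q) => M i j) ul).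
exact: coord_continuous.
Qed.

Lemma cvg_mulmxl (p q : nat) (A : 'M[R]_(p, q)) (u : T -> 'cV[R]_q) (l : 'cV[R]_q) :
  u x @[x --> F] --> l -> A *m u x @[x --> F] --> A *m l.
Proof.
move=> ul; apply: cvg_cV => j; rewrite mxE; under eq_fun do rewrite mxE.
by apply: cvg_sum_seq => i _; apply: cvgMl_tmp; exact: cvg_coord.
Qed.

Variables (d : nat) (D : {dot 'cV[R]_d for idfun}).

Lemma cvg_dot (u v : T -> 'cV[R]_d) (a b : 'cV[R]_d) :
  u x @[x --> F] --> a -> v x @[x --> F] --> b ->
  D (u x) (v x) @[x --> F] --> D a b.
Proof.
move=> ua vb.
have E s t : D s t = \sum_i s i 0 * (gram D *m t) i 0.
  by rewrite dot_gram -mulmxA mxE; apply: eq_bigr => i _; rewrite mxE.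
rewrite E; under eq_fun => x do rewrite E.
apply: cvg_sum_seq => i _; apply: cvgM; first exact: cvg_coord.
by apply: cvg_coord; exact: cvg_mulmxl.
Qed.

Lemma dot_cvg0 (u : T -> 'cV[R]_d) :
  D (u x) (u x) @[x --> F] --> (0 : R) -> u x @[x --> F] --> (0 : 'cV[R]_d).
Proof.
move=> u0; apply: cvg_cV => j; rewrite mxE.
have [C C0 uC] := coord_le_dot D j.
have h : Num.sqrt (C * D (u x) (u x)) @[x --> F] --> (0 : R).
  have Cu : C * D (u x) (u x) @[x --> F] --> C * 0 by exact: cvgMl_tmp.
  rewrite -sqrtr0 -(mulr0 C).
  apply: (cvg_comp _ Num.sqrt Cu); exact: sqrt_continuous.
apply/norm_cvg0P; apply: squeeze_cvgr (cvg_cst 0) h.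
apply: nearW => x; rewrite normr_ge0 /= -sqrtr_sqr ler_wsqrtr //.
Qed.

Lemma dot_cvgP (u : T -> 'cV[R]_d) (l : 'cV[R]_d) :
  D (u x - l) (u x - l) @[x --> F] --> (0 : R) -> u x @[x --> F] --> l.
Proof.
move=> /dot_cvg0 ul; rewrite -[X in _ --> X](add0r l).
rewrite (_ : u = fun x => (u x - l) + l); last by apply/funext => x; rewrite subrK.
by apply: cvgD => //; exact: cvg_cst.
Qed.

End Convergence.

Arguments cvg_dot {R T F FF d} D {u v a b}.
Arguments dot_cvg0 {R T F FF d} D {u}.
Arguments dot_cvgP {R T F FF d} D {u l}.

(** * Limits along an ultrafilter *)

Section Ultra.
Context {R : realType} {T : Type} {U : set_system T} {UU : UltraFilter U}.

(** Every set or its complement has its preimage in [U], so no proper filter is strictly finer than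
    the image. *)
Lemma ultra_image (T' : Type) (g : T -> T') : UltraFilter (g x @[x --> U]).
Proof.
have UP : ProperFilter (g x @[x --> U]) by exact: fmap_proper_filter.
split=> // G GP sub.
apply/seteqP; split=> [A GA|]; last exact: sub.
have [UA|UA] := in_ultra_setVsetC (g @^-1` A) UU; first exact: UA.
have /sub GA' : (g x @[x --> U]) (~` A) by [].
have G0 : G set0 by rewrite -(setICr A); exact: filterI.
by have := @filter_not_empty _ G GP G0.
Qed.

Lemma ultra_cvg_real (u : T -> R) M :
  (\forall x \near U, `|u x| <= M) -> exists l : R, u x @[x --> U] --> l.
Proof.
move=> uM; have := @segment_compact R (- M) M; rewrite compact_ultra.
move=> /(_ _ (ultra_image u)).
case=> [|l [_ ul]]; last by exists l.
apply: filterS uM => x /=; by rewrite in_itv /= ler_norml.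
Qed.

(** Bolzano-Weierstrass without subsequences: one ultrafilter serves all bounded sequences at
    once. *)
Lemma ultra_cvg_dot (d : nat) (D : {dot 'cV[R]_d for idfun})
    (u : T -> 'cV[R]_d) M :
  (\forall x \near U, D (u x) (u x) <= M) ->
  exists l : 'cV[R]_d, u x @[x --> U] --> l.
Proof.
move=> uM.
have /choice[l ul] j : exists l : R, u x j 0 @[x --> U] --> l.
  have [C C0 uC] := coord_le_dot D j.
  apply: (@ultra_cvg_real _ (Num.sqrt (C * M))).
  apply: filterS uM => x h; rewrite -sqrtr_sqr ler_wsqrtr //.
  by apply: le_trans (uC _) _; rewrite ler_wpM2l.
exists (\col_j l j); apply: cvg_cV => j; rewrite mxE; exact: ul.
Qed.

End Ultra.

Arguments ultra_cvg_dot {R T U UU d} D {u} M.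

(** * Projections and cones *)

Section Cones.
Variables (R : realType) (d : nat) (D : {dot 'cV[R]_d for idfun}).
Implicit Types (C K : set 'cV[R]_d) (u v w z : 'cV[R]_d).

Lemma ipnorm_sqr u : ipnorm D u ^+ 2 = D u u.
Proof. by rewrite sqr_sqrtr // dot_ge0. Qed.

(** The limit [t -> 0], used as the first-order condition of a minimum along a segment. *)
Lemma affine_near0_ge0 (a b : R) :
  (forall t, 0 < t <= 1 -> 0 <= a + t * b) -> 0 <= a.
Proof.
move=> h; rewrite leNgt; apply/negP => a0.
have c0 : 0 < - a + `|b| by rewrite ltr_pwDl ?oppr_gt0.
(* If [a < 0], this [t] lies in []0, 1]] and makes [a + t * b] negative. *)
have := h (- a / (- a + `|b|)).
rewrite divr_gt0 ?oppr_gt0 //= ler_pdivrMr // mul1r lerDl normr_ge0.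
move=> /(_ isT); rewrite leNgt => /negP; apply.
rewrite -(pmulr_llt0 _ c0) mulrDl mulrAC divfK ?gt_eqF //.
have := ler_norm b => hb; nra.
Qed.

(** Convexity with plain real weights, in the range of [t] that [affine_near0_ge0] supplies. *)
Definition segment_closed C := forall u w t,
  C u -> C w -> 0 < t <= 1 -> C (t *: u + (1 - t) *: w).

Lemma convex_set_segment C : convex_set C -> segment_closed C.
Proof.
move=> cC u w t Cu Cw /andP[t0 t1].
have /set_mem := cC u w (Itv01 (ltW t0) t1) (mem_set Cu) (mem_set Cw).
by [].
Qed.

(** Minimality on the segment from [z] to [w]: expand the square, divide by [t] and let [t] tend to
    0. *)
Lemma proj_variational C v z w :
  segment_closed C -> is_proj D C v z -> C w -> D (w - z) (v - z) <= 0.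
Proof.
move=> cC [Cz zmin] Cw; rewrite -oppr_ge0.
suff : 0 <= - (2 * D (w - z) (v - z)) by lra.
apply: (@affine_near0_ge0 _ (D (w - z) (w - z))) => t t01.
have /andP[t0 _] := t01.
have := zmin _ (cC _ _ _ Cw Cz t01); rewrite lee_fin => /(lerXn2r 2).
rewrite !nnegrE !sqrtr_ge0 !ipnorm_sqr => /(_ isT isT).
have -> : t *: w + (1 - t) *: z - v = - (v - z) + t *: (w - z).
  by apply/colP => i; rewrite !mxE; lra.
rewrite -[z - v]opprB; move: (w - z) (v - z) => a c.
rewrite !dotE (dotC D c a) => h.
rewrite -(pmulr_rge0 _ t0); lra.
Qed.

(** A minimizing sequence stays at bounded distance from [v], so it converges along an ultrafilter,
    and closedness keeps the limit in [C]. *)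
Lemma proj_exists C v : closed C -> C !=set0 -> exists z, is_proj D C v z.
Proof.
move=> clC C0; pose q u := D (u - v) (u - v).
have qinf : has_inf (q @` C).
  split; first by case: C0 => c Cc; exists (q c); exists c.
  by exists 0 => _ [u _ <-]; exact: dot_ge0.
pose I := inf (q @` C).
have /choice[u uP] (k : nat) : exists u, C u /\ q u < I + k.+1%:R^-1.
  have [//|_ [u Cu <-] qu] := @inf_adherent _ _ k.+1%:R^-1 _ qinf.
  by exists u.
have [U [UU ooU]] := ultraFilterLemma (@eventually_filter).
have [l ul] : exists l : 'cV[R]_d, (u k - v) @[k --> U] --> l.
  apply: (ultra_cvg_dot D (I + 1)).
  apply: nearW => k; apply: le_trans (ltW (uP k).2) _.
  by rewrite lerD2l invf_le1 ?ler1n.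
have uz : u k @[k --> U] --> l + v.
  rewrite (_ : u = fun k => u k - v + v); last first.
    by apply/funext => k; rewrite subrK.
  by apply: cvgD => //; exact: cvg_cst.
exists (l + v); split.
  by apply: (closed_cvg _ clC _ _ uz); apply: nearW => k; exact: (uP k).1.
move=> w Cw; rewrite lee_fin addrK ler_wsqrtr //.
apply: (@le_trans _ _ I); last by apply: ge_inf; [exact: qinf.2|exists w].
have e0 : I + k.+1%:R^-1 @[k --> U] --> I.
  rewrite -[X in _ --> X]addr0; apply: cvgD; first exact: cvg_cst.
  by apply: cvg_trans (cvg_fmap2 ooU) _; exact: cvg_harmonic.
apply: ler_cvg_to (cvg_dot D ul ul) e0 _.
by apply: nearW => k; exact/ltW/(uP k).2.
Qed.

Lemma polarP K w : polar D K w <-> forall u, K u -> D u w <= 0.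
Proof.
split=> [/ereal_supP h u Ku|h].
  by rewrite -lee_fin; apply: h; exists u.
by apply/ereal_supP => _ [u Ku <-]; rewrite lee_fin h.
Qed.

Lemma polar_segment K : segment_closed (polar D K).
Proof.
move=> u w t /polarP Ku /polarP Kw /andP[t0 t1]; apply/polarP => x Kx.
rewrite !dotE; have := Ku x Kx; have := Kw x Kx; nra.
Qed.

Lemma polarZ K w t : 0 <= t -> polar D K w -> polar D K (t *: w).
Proof.
move=> t0 /polarP h; apply/polarP => u Ku.
by rewrite dotZr mulr_ge0_le0 // h.
Qed.

(** Testing the variational inequality at [2 z] and at [z / 2] gives both signs. *)
Lemma proj_cone_orthogonal C v z :
    segment_closed C -> (forall t w, 0 < t -> C w -> C (t *: w)) ->
  is_proj D C v z -> D z (v - z) = 0.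
Proof.
move=> cC coneC zP; have Cz := zP.1.
have := proj_variational cC zP (coneC 2 z ltac:(by []) Cz).
have h0 : 0 < 2^-1 :> R by rewrite invr_gt0.
have := proj_variational cC zP (coneC 2^-1 z h0 Cz).
rewrite !dotBl !dotZl => h1 h2; lra.
Qed.

(** Project [v] on [K]: the residual [v - z] is polar to [K] and orthogonal to [z], so its squared
    norm is [D (v - z) v], which is at most 0. *)
Lemma bipolar K v : K !=set0 -> closed K -> segment_closed K -> cone K ->
  (forall w, polar D K w -> D w v <= 0) -> K v.
Proof.
move=> K0 clK cK coneK h.
have [z zP] := proj_exists v clK K0.
have z0 := proj_cone_orthogonal cK coneK zP.
have /h : polar D K (v - z).
  apply/polarP => u Ku; have := proj_variational cK zP Ku.
  by rewrite dotBl z0 subr0.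
have : D (v - z) (v - z) = D (v - z) v - D z (v - z).
  by rewrite [in LHS]dotBr (dotC D (v - z) z).
rewrite z0 subr0 => <- vz; have vz0 := dot_ge0 D (v - z).
have /dot_eq0/eqP : D (v - z) (v - z) = 0 by lra.
by rewrite subr_eq0 => /eqP ->; exact: zP.1.
Qed.

(** By the bipolar theorem it suffices to test against polar vectors, term by term. An empty index
    type yields that 0 lies in [K]. *)
Lemma cone_sum (I : finType) K (F : I -> 'cV[R]_d) :
    K !=set0 -> closed K -> segment_closed K -> cone K ->
  (forall i, K (F i)) -> K (\sum_i F i).
Proof.
move=> K0 clK cK coneK KF; apply: bipolar => // w /polarP wK.
rewrite dot_sumr sumr_le0 // => i _; rewrite dotC; exact: wK.
Qed.

End Cones.

(* The inclusion [- A^* y \in \partial f x], with [y = c^-1 (A x + r)], stated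
   without the adjoint. *)
Lemma argmin_subgradient (R : realType) (d m : nat) (D : {dot 'cV[R]_m for idfun})
    (f : 'cV[R]_d -> \bar R) (A : 'M[R]_(m, d)) (r : 'cV[R]_m) (c : R) x :
    0 < c -> convex_efun f -> proper_fun f ->
    is_minimizer setT
      (fun u => (f u + ((2 * c)^-1 * ipnorm D (A *m u + r) ^+ 2)%:E)%E) x ->
  f x \is a fin_num /\
  forall u, (f x <= f u + (D (c^-1 *: (A *m x + r)) (A *m u - A *m x))%:E)%E.
Proof.
move=> c0 fconv [fNy [u0 fu0]] [_ xmin].
have fxfin : f x \is a fin_num.
  rewrite fin_numE; apply/andP; split; first by rewrite gt_eqF.
  apply/negP => /eqP fx; have := xmin u0 I; rewrite fx addye // leye_eq.
  have : f u0 \is a fin_num by rewrite fin_real // fNy fu0.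
  by move=> /fineK <-; rewrite -EFinD.
split=> // u.
have [fu|] := boolP (f u \is a fin_num); last first.
  rewrite fin_numE negb_and !negbK => /orP[/eqP fu|/eqP ->].
    by have := fNy u; rewrite fu ltxx.
  by rewrite addye // leey.
move: (fxfin) (fu) => /fineK fx' /fineK fu'.
rewrite -fx' -fu' -EFinD lee_fin.
set a := fine _ in fx' *; set b := fine _ in fu' *.
have Eg t : A *m (t *: u + (1 - t) *: x) + r
    = A *m x + r + t *: (A *m u - A *m x).
  rewrite mulmxDr -!scalemxAr; apply/colP => i; rewrite !mxE; lra.
move: (A *m x + r) (A *m u - A *m x) Eg xmin => g h Eg xmin.
(* Minimality is compared with convexity on the segment to [u]; the square of the increment is of
   order [t ^ 2], so after division by [t] only the linear part survives in the limit. *)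
rewrite -subr_ge0; apply: (@affine_near0_ge0 _ _ ((2 * c)^-1 * D h h)) => t t01.
have /andP[t0 t1] := t01.
have := fconv u x t; rewrite (ltW t0) t1 => /(_ isT).
have := xmin (t *: u + (1 - t) *: x) I.
rewrite !ipnorm_sqr Eg.
rewrite -fx' -fu' -!EFinM -!EFinD.
case: (f _) (fNy (t *: u + (1 - t) *: x)) => // e _.
rewrite -!EFinD !lee_fin !dotE (dotC D h g) invfM.
have c'0 : 0 < c^-1 by rewrite invr_gt0.
move: c^-1 c'0 => k k0 h1 h2; rewrite -(pmulr_rge0 _ t0); lra.
Qed.

(** * The Lyapunov function *)

Section RealSequences.
Variable R : realType.

(** [v] decreases and is bounded below, so its consecutive differences tend to 0, and they dominate
    [e]. *)
Lemma telescoping_cvg0 (v e : nat -> R) :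
    (forall k, 0 <= v k) -> (forall k, 0 <= e k) ->
    (forall k, v k.+1 + e k <= v k) ->
  (forall k l, (k <= l)%N -> v l <= v k) /\ e k @[k --> \oo] --> (0 : R).
Proof.
move=> v0 e0 ve.
have vmono : {homo v : k l / (k <= l)%N >-> l <= k}.
  by apply/nonincreasing_seqP => k; have := ve k; have := e0 k; lra.
split=> [k l kl|]; first exact: vmono.
have vcvg : cvgn v.
  by apply: nonincreasing_is_cvgn => //; exists 0 => _ [k _ <-].
have d0 : v k - v k.+1 @[k --> \oo] --> (0 : R).
  rewrite -(subrr (limn v)); apply: cvgB => //.
  by rewrite (cvg_shiftS v).
apply: squeeze_cvgr (cvg_cst 0) d0.
by apply: nearW => k; rewrite e0 /=; have := ve k; lra.
Qed.

(** One positive index where [v] is small is enough, since [v] stays below that value afterwards.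
    Positivity is asked because monotonicity is given from index 1 on. *)
Lemma ultra_nonincreasing_cvg0 (v : nat -> R) (U : set_system nat) :
    ProperFilter U -> \oo `<=` U -> (forall k, 0 <= v k) ->
    (forall k l, (k <= l)%N -> v l.+1 <= v k.+1) ->
  v k @[k --> U] --> (0 : R) -> v k @[k --> \oo] --> (0 : R).
Proof.
move=> UP ooU v0 vmono /cvgr0Pnorm_lt vU.
apply/cvgr0Pnorm_lt => e e0.
have [k [vk k0]] := filter_ex (filterI (vU e e0) (ooU _ (nbhs_infty_gt 0))).
near=> l; apply: le_lt_trans vk; rewrite !ger0_norm //.
have kl : (k <= l)%N by near: l; exact: nbhs_infty_ge.
by rewrite -(prednK k0) -(prednK (leq_trans k0 kl)) vmono // -ltnS !prednK //
  (leq_trans k0).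
Unshelve. all: by end_near. Qed.

Lemma ler_sum_term (I : finType) (P : pred I) (F : I -> R) i :
  (forall j, P j -> 0 <= F j) -> P i -> F i <= \sum_(j | P j) F j.
Proof.
move=> F0 Pi; rewrite (bigD1 i) //= lerDl.
by apply: sumr_ge0 => j /andP[/F0].
Qed.

Lemma cvgD0_real (T : Type) (F : set_system T) {FF : Filter F} (f g : T -> R) :
  f k @[k --> F] --> (0 : R) -> g k @[k --> F] --> (0 : R) ->
  f k + g k @[k --> F] --> (0 : R).
Proof. by move=> f0 g0; rewrite -(addr0 0); exact: cvgD. Qed.

Lemma cvgM0_real (T : Type) (F : set_system T) {FF : Filter F} c (f : T -> R) :
  f k @[k --> F] --> (0 : R) -> c * f k @[k --> F] --> (0 : R).
Proof. by move=> f0; rewrite -(mulr0 c); exact: cvgMl_tmp. Qed.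

Lemma cvg0_dom (T : Type) (F : set_system T) {FF : Filter F} (e u : T -> R) c :
    (forall k, 0 <= u k) -> (forall k, u k <= c * e k) ->
  e k @[k --> F] --> (0 : R) -> u k @[k --> F] --> (0 : R).
Proof.
move=> u0 ue e0; apply: squeeze_cvgr (cvg_cst 0) _; last first.
  rewrite -(mulr0 c); apply: cvgMl_tmp; exact: e0.
by apply: nearW => k; rewrite u0 ue.
Qed.

End RealSequences.

Section Limits.
Context {R : realType} {d : nat}.
Implicit Types u v w : nat -> 'cV[R]_d.

Lemma cvg_finer (F G : set_system nat) u (l : 'cV[R]_d) :
  F `<=` G -> u k @[k --> F] --> l -> u k @[k --> G] --> l.
Proof. by move=> FG ul A /ul; exact: FG. Qed.

Lemma cvg_sub0 (F : set_system nat) {FF : Filter F} u v (l : 'cV[R]_d) :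
  u k - v k @[k --> F] --> (0 : 'cV[R]_d) -> v k @[k --> F] --> l ->
  u k @[k --> F] --> l.
Proof.
move=> uv vl; rewrite -[X in _ --> X](add0r l).
rewrite (_ : u = fun k => (u k - v k) + v k); last first.
  by apply/funext => k; rewrite subrK.
exact: cvgD.
Qed.

Lemma cvg_shift2 u (l : 'cV[R]_d) :
  u k.+2 @[k --> \oo] --> l -> u k @[k --> \oo] --> l.
Proof. by rewrite -(cvg_shiftS u) -(cvg_shiftS (fun k => u k.+1)). Qed.

Lemma cvg_shift1 u (l : 'cV[R]_d) :
  u k.+1 @[k --> \oo] --> l -> u k @[k --> \oo] --> l.
Proof. by rewrite -(cvg_shiftS u). Qed.

Lemma cvgD0 (F : set_system nat) {FF : Filter F} u v :
  u k @[k --> F] --> (0 : 'cV[R]_d) -> v k @[k --> F] --> (0 : 'cV[R]_d) ->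
  u k + v k @[k --> F] --> (0 : 'cV[R]_d).
Proof. by move=> u0 v0; rewrite -(addr0 0); exact: cvgD. Qed.

Lemma cvgZ0 (F : set_system nat) {FF : Filter F} c u :
  u k @[k --> F] --> (0 : 'cV[R]_d) -> c *: u k @[k --> F] --> (0 : 'cV[R]_d).
Proof. by move=> u0; rewrite -(scaler0 _ c); exact: cvgZl_tmp. Qed.

End Limits.

(** * Energy estimates on the graph *)

Section Lyapunov.
Variables (R : realType) (m : nat) (D : {dot 'cV[R]_m for idfun}).
Variables (sigma rho : R) (sigma_gt0 : 0 < sigma) (rho_gt0 : 0 < rho).

(** The vectors are deviations from a reference point. With [y = z1 + sigma^-1 (s2 - s1)] and
    [dot_subl_self], the right side exceeds the left by [2 D z1 s2 + 2 D (z1 - z0) (s2 - s1)]. *)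
Lemma node_inequality (y z1 z0 s2 s1 : 'cV[R]_m) :
    s2 = s1 + sigma *: (y - z1) -> 0 <= D z1 s2 ->
    0 <= D (z1 - z0) (s2 - s1) ->
  sigma^-1 * D s2 s2 + sigma * D z1 z1
  + (sigma^-1 * D (s2 - s1) (s2 - s1) + sigma * D (z1 - z0) (z1 - z0))
  - (sigma^-1 * D s1 s1 + sigma * D z0 z0)
  <= 2 * D y (s2 + sigma *: (z1 - z0)).
Proof.
move=> s2E z1s2 zs.
have -> : y = z1 + sigma^-1 *: (s2 - s1).
  rewrite s2E addrC [s1 + _]addrC addrK scalerA mulVf ?gt_eqF // scale1r.
  by rewrite subrK.
have h1 := dot_subl_self D s2 s1; have h2 := dot_subl_self D z1 z0.
move: z1s2 zs h1 h2; rewrite (dotC D (z1 - z0) (s2 - s1)).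
have -> : D (z1 + sigma^-1 *: (s2 - s1)) (s2 + sigma *: (z1 - z0)) =
  D z1 s2 + sigma * D (z1 - z0) z1 + sigma^-1 * D (s2 - s1) s2
  + D (s2 - s1) (z1 - z0).
  move: (s2 - s1) (z1 - z0) => ds dz; rewrite !dotE (dotC D dz z1).
  by rewrite mulrCA mulrA mulVf ?gt_eqF // mul1r; lra.
have k0 : 0 < sigma^-1 by rewrite invr_gt0.
move: sigma^-1 k0 => k k0; move: (D (s2 - s1) s2) (D (z1 - z0) z1) => p q.
move: (D (s2 - s1) (s2 - s1)) (D (z1 - z0) (z1 - z0)) => p' q' *.
nra.
Qed.

(** Both orientations of one edge together: [xi], [xj] are the previous values of [yi], [yj], and
    [l + (yi - yj)] is the next edge variable. The edge energy balances exactly. *)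
Lemma edge_identity (yi yj xi xj l : 'cV[R]_m) :
  2 * D yi (l + ((yi - yj) + (yi - xi) + (yj - xj)))
  + 2 * D yj (- l + ((yj - yi) + (yj - xj) + (yi - xi)))
  = D (l + (yi - yj)) (l + (yi - yj)) + D (yi + yj) (yi + yj)
    + (D (yi - yj) (yi - yj) + D (yi + yj - (xi + xj)) (yi + yj - (xi + xj)))
    - (D l l + D (xi + xj) (xi + xj)).
Proof.
rewrite !dotE.
rewrite (dotC D l yi) (dotC D l yj) (dotC D yj yi) (dotC D xi yi) (dotC D xi yj).
rewrite (dotC D xj yi) (dotC D xj yj) (dotC D xj xi); lra.
Qed.

Variables (N : nat) (E : rel 'I_N) (E_sym : symmetric E).

Lemma sum_edges_swap (V : nmodType) (F : 'I_N * 'I_N -> V) :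
  \sum_(p | E p.1 p.2) F p = \sum_(p | E p.1 p.2) F (p.2, p.1).
Proof.
rewrite (reindex_inj (h := fun p => (p.2, p.1))) /=; last first.
  by move=> [i j] [i' j'] [-> ->].
by apply: eq_bigl => p; rewrite E_sym.
Qed.

Lemma sum_nbrs (V : nmodType) (F : 'I_N -> 'I_N -> V) :
  \sum_i \sum_(j in nbrs E i) F i j = \sum_(p | E p.1 p.2) F p.1 p.2.
Proof.
rewrite pair_big_dep /=; apply: eq_big => [[i j]|[i j] _] //=.
by rewrite inE.
Qed.

(** Reversing the edges turns the sum into its opposite. *)
Lemma sum_antisymmetric (l : 'I_N -> 'I_N -> 'cV[R]_m) :
    (forall i j, E i j -> l j i = - l i j) ->
  \sum_i \sum_(j in nbrs E i) l i j = 0.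
Proof.
move=> l_anti; rewrite sum_nbrs; set S := \sum_(_ | _) _.
have : S = - S.
  rewrite {1}/S (sum_edges_swap (fun p => l p.1 p.2)) /= -sumrN.
  by apply: eq_bigr => q; exact: l_anti.
move=> SN; apply/colP => j; have := congr1 (fun u : 'cV[R]_m => u j 0) SN.
by rewrite !mxE; lra.
Qed.

Variables (y z s a : 'I_N -> nat -> 'cV[R]_m).
Variable lam : 'I_N -> 'I_N -> nat -> 'cV[R]_m.
Hypothesis lam_step : forall i j k, lam i j k.+1 = lam i j k + (y i k - y j k).
Hypothesis lam_anti : forall i j k, lam j i k = - lam i j k.
Hypothesis s_step : forall i k, s i k.+1 = s i k + sigma *: (y i k - z i k).
Hypothesis a_step : forall i k, a i k.+1 =
  rho *: (\sum_(j in nbrs E i)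
            (lam i j k.+1 + ((y i k.+1 - y j k.+1) + (y i k.+1 - y i k)
                             + (y j k.+1 - y j k))))
  + (s i k.+2 + sigma *: (z i k.+1 - z i k)).
(** Monotonicity starts at index 1 because the initial values are arbitrary; [s i k.+2] accompanies
    [z i k.+1] as the normal vector left by that projection. *)
Hypothesis y_mono : forall i k l,
  D (y i k.+1 - y i l.+1) (a i k.+1 - a i l.+1) <= 0.
Hypothesis z_mono : forall i k l,
  0 <= D (z i k.+1 - z i l.+1) (s i k.+2 - s i l.+2).

(* [a i k] stands for [A i x_i^k - b i].  Of the optimality conditions only the
   monotonicity inequalities are kept: unlike the existence of a primal point [x]
   with [A i x_i - b i = rho sum_j lb i j + sb i], they pass to the limit. *)
Record reference (yb : 'cV[R]_m) (sb : 'I_N -> 'cV[R]_m)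
    (lb : 'I_N -> 'I_N -> 'cV[R]_m) : Prop := Reference {
  ref_anti : forall i j, E i j -> lb j i = - lb i j;
  ref_y : forall i k, D (y i k.+1 - yb)
            (a i k.+1 - (rho *: (\sum_(j in nbrs E i) lb i j) + sb i)) <= 0;
  ref_z : forall i k, 0 <= D (z i k.+1 - yb) (s i k.+2 - sb i) }.

Definition nsq u := D u u.

(** Here [s], and [lam] in [lyap_edge], are taken one step ahead: for positive [k] the normal vector
    at [z i k] is [s i k.+1]. *)
Definition lyap_node yb sb i k :=
  sigma^-1 * nsq (s i k.+1 - sb i) + sigma * nsq (z i k - yb).
Definition lyap_edge yb lb (p : 'I_N * 'I_N) k :=
  nsq (lam p.1 p.2 k.+1 - lb p.1 p.2) + nsq ((y p.1 k - yb) + (y p.2 k - yb)).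
Definition lyap (yb : 'cV[R]_m) (sb : 'I_N -> 'cV[R]_m)
    (lb : 'I_N -> 'I_N -> 'cV[R]_m) k : R :=
  \sum_i lyap_node yb sb i k
  + rho / 2 * \sum_(p | E p.1 p.2) lyap_edge yb lb p k.

Definition decr_node i k :=
  sigma^-1 * nsq (s i k.+2 - s i k.+1) + sigma * nsq (z i k.+1 - z i k).
Definition decr_edge (p : 'I_N * 'I_N) k :=
  nsq (y p.1 k.+1 - y p.2 k.+1)
  + nsq (y p.1 k.+1 + y p.2 k.+1 - (y p.1 k + y p.2 k)).
Definition decr k : R :=
  \sum_i decr_node i k + rho / 2 * \sum_(p | E p.1 p.2) decr_edge p k.

(** Node inequalities and edge identities add up, at each node, to twice the product of [y - yb]
    with the deviation of [a] from the reference residual; [ref_y] makes it nonpositive. *)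
Lemma lyap_decr yb sb lb k : reference yb sb lb ->
  lyap yb sb lb k.+2 + decr k.+1 <= lyap yb sb lb k.+1.
Proof.
move=> [lb_anti yb_y zb_z]; rewrite -subr_le0.
pose t i n := y i n - yb.
pose l (p : 'I_N * 'I_N) := lam p.1 p.2 k.+2 - lb p.1 p.2.
(* [q] and [g] are the node part and the edge part of the deviation of [a] from the reference. *)
pose q i := s i k.+3 - sb i + sigma *: (z i k.+2 - z i k.+1).
pose g (p : 'I_N * 'I_N) := l p +
  ((t p.1 k.+2 - t p.2 k.+2) + (t p.1 k.+2 - t p.1 k.+1)
   + (t p.2 k.+2 - t p.2 k.+1)).
pose G (p : 'I_N * 'I_N) := 2 * D (t p.1 k.+2) (g p).
have tB i j n n' : t i n - t j n' = y i n - y j n'.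
  by rewrite /t opprB addrA subrK.
have tDB i j n n' :
    t i n + t j n - (t i n' + t j n') = y i n + y j n - (y i n' + y j n').
  by rewrite opprD addrACA !tB addrACA -opprD.
have l_swap i j : E i j -> l (j, i) = - l (i, j).
  by move=> Eij; rewrite /l /= lb_anti // lam_anti opprB opprK addrC.
have edgeE p : E p.1 p.2 ->
    lyap_edge yb lb p k.+2 + decr_edge p k.+1 - lyap_edge yb lb p k.+1
    = G p + G (p.2, p.1).
  case: p => i j /= Eij; rewrite /G /g /= (l_swap _ _ Eij) edge_identity.
  rewrite /l /lyap_edge /decr_edge /nsq /= !tB tDB /t.
  by rewrite lam_step [lam i j k.+2 + _ - _]addrAC.
have nodeE i : lyap_node yb sb i k.+2 + decr_node i k.+1
    - lyap_node yb sb i k.+1 <= 2 * D (t i k.+2) (q i).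
  have := @node_inequality (t i k.+2) (z i k.+2 - yb) (z i k.+1 - yb)
    (s i k.+3 - sb i) (s i k.+2 - sb i).
  rewrite !opprB !addrA !subrK; apply; last exact: z_mono.
    by rewrite s_step addrAC.
  exact: zb_z.
apply: (@le_trans _ _ (\sum_i 2 * D (t i k.+2) (q i)
   + rho / 2 * \sum_(p | E p.1 p.2) (G p + G (p.2, p.1)))).
  rewrite /lyap /decr.
  rewrite (_ : _ - _ = \sum_i (lyap_node yb sb i k.+2 + decr_node i k.+1
    - lyap_node yb sb i k.+1) + rho / 2 * \sum_(p | E p.1 p.2)
    (lyap_edge yb lb p k.+2 + decr_edge p k.+1 - lyap_edge yb lb p k.+1)).
    rewrite lerD ?ler_sum // (eq_bigr _ edgeE) //.
  rewrite !sumrB !big_split /=; lra.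
have sumG : \sum_(p | E p.1 p.2) G p =
    \sum_i 2 * D (t i k.+2) (\sum_(j in nbrs E i) g (i, j)).
  transitivity (\sum_(p | E p.1 p.2) G (p.1, p.2)).
    by apply: eq_bigr => -[].
  rewrite -(sum_nbrs (fun i j => G (i, j))); apply: eq_bigr => i _.
  by rewrite dot_sumr mulr_sumr.
(* The two orientations contribute equally, which turns [rho / 2] into [rho]. *)
rewrite big_split /= -(sum_edges_swap G).
have -> x : rho / 2 * (x + x) = rho * x by lra.
rewrite sumG mulr_sumr -big_split /=; apply: sumr_le0 => i _.
have := yb_y i k.+1.
have -> : a i k.+2 - (rho *: (\sum_(j in nbrs E i) lb i j) + sb i)
    = q i + rho *: \sum_(j in nbrs E i) g (i, j).
  rewrite a_step opprD addrACA -scalerBr -sumrB addrC.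
  congr (_ + _ *: _); first by rewrite /q addrAC.
  apply: eq_bigr => j _.
  by rewrite /g /l /= !tB addrAC.
rewrite dotDr dotZr; lra.
Qed.

Lemma nsq_ge0 u : 0 <= nsq u. Proof. exact: dot_ge0. Qed.

Lemma energy_node (fn : 'I_N -> R) (fe : 'I_N * 'I_N -> R) i :
  (forall i, 0 <= fn i) -> (forall p, 0 <= fe p) ->
  fn i <= \sum_i fn i + rho / 2 * \sum_(p | E p.1 p.2) fe p.
Proof.
move=> fn0 fe0; apply: le_trans (ler_sum_term (P := predT) (i := i) _ _) _ => //.
by rewrite lerDl mulr_ge0 ?sumr_ge0 // divr_ge0 // ltW.
Qed.

Lemma energy_edge (fn : 'I_N -> R) (fe : 'I_N * 'I_N -> R) i j :
  (forall i, 0 <= fn i) -> (forall p, 0 <= fe p) -> E i j ->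
  rho / 2 * fe (i, j) <= \sum_i fn i + rho / 2 * \sum_(p | E p.1 p.2) fe p.
Proof.
move=> fn0 fe0 Eij; rewrite ler_wpDl ?sumr_ge0 // ler_wpM2l //.
  by rewrite divr_ge0 // ltW.
by apply: (@ler_sum_term _ _ (fun p => E p.1 p.2) fe (i, j)).
Qed.

Lemma lyap_node_ge0 yb sb i k : 0 <= lyap_node yb sb i k.
Proof.
by rewrite addr_ge0 ?mulr_ge0 ?nsq_ge0 ?invr_ge0 // ltW.
Qed.

Lemma decr_node_ge0 i k : 0 <= decr_node i k.
Proof.
by rewrite addr_ge0 ?mulr_ge0 ?nsq_ge0 ?invr_ge0 // ltW.
Qed.

Lemma lyap_edge_ge0 yb lb p k : 0 <= lyap_edge yb lb p k.
Proof. by rewrite addr_ge0 ?nsq_ge0. Qed.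

Lemma decr_edge_ge0 p k : 0 <= decr_edge p k.
Proof. by rewrite addr_ge0 ?nsq_ge0. Qed.

Let le_inv_scaled (c b e v : R) : 0 < c -> 0 <= b -> c * e + b <= v -> e <= c^-1 * v.
Proof. by move=> c0 b0 h; rewrite ler_pdivlMl //; lra. Qed.

Lemma lyap_s yb sb lb i k :
  nsq (s i k.+1 - sb i) <= sigma * lyap yb sb lb k.
Proof.
rewrite -[X in _ <= X * _]invrK; apply: (le_inv_scaled (b := sigma * nsq (z i k - yb))).
- by rewrite invr_gt0.
- by rewrite mulr_ge0 ?nsq_ge0 // ltW.
- apply: (energy_node (fn := fun i => lyap_node yb sb i k)) => [j|p].
    exact: lyap_node_ge0.
  exact: lyap_edge_ge0.
Qed.

Lemma lyap_z yb sb lb i k :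
  nsq (z i k - yb) <= sigma^-1 * lyap yb sb lb k.
Proof.
apply: (le_inv_scaled (b := sigma^-1 * nsq (s i k.+1 - sb i))) => //.
- by rewrite mulr_ge0 ?nsq_ge0 // invr_ge0 ltW.
- rewrite addrC.
  apply: (energy_node (fn := fun i => lyap_node yb sb i k)) => [j|p].
    exact: lyap_node_ge0.
  exact: lyap_edge_ge0.
Qed.

Lemma lyap_lam yb sb lb i j k : E i j ->
  nsq (lam i j k.+1 - lb i j) <= (rho / 2)^-1 * lyap yb sb lb k.
Proof.
move=> Eij.
apply: (le_inv_scaled (b := rho / 2 * nsq ((y i k - yb) + (y j k - yb)))).
- by rewrite divr_gt0.
- by rewrite mulr_ge0 ?nsq_ge0 // divr_ge0 // ltW.
- rewrite -mulrDr.
  apply: (energy_edge (fe := fun p => lyap_edge yb lb p k)) => // [l|p].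
    exact: lyap_node_ge0.
  exact: lyap_edge_ge0.
Qed.

Lemma lyap_ge0 yb sb lb k : 0 <= lyap yb sb lb k.
Proof.
rewrite addr_ge0 ?sumr_ge0 // => [i _|]; first exact: lyap_node_ge0.
apply: mulr_ge0; first by rewrite divr_ge0 // ltW.
apply: sumr_ge0 => p _; exact: lyap_edge_ge0.
Qed.

Lemma decr_ge0 k : 0 <= decr k.
Proof.
rewrite addr_ge0 ?sumr_ge0 // => [i _|]; first exact: decr_node_ge0.
apply: mulr_ge0; first by rewrite divr_ge0 // ltW.
apply: sumr_ge0 => p _; exact: decr_edge_ge0.
Qed.

Lemma reference_decr yb sb lb : reference yb sb lb ->
  (forall k l, (k <= l)%N -> lyap yb sb lb l.+1 <= lyap yb sb lb k.+1) /\
  decr k.+1 @[k --> \oo] --> (0 : R).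
Proof.
move=> ref; apply: (@telescoping_cvg0 _ (fun k => lyap yb sb lb k.+1)) => k.
- exact: lyap_ge0.
- exact: decr_ge0.
- exact: lyap_decr.
Qed.

(** Each squared difference is, up to a constant, one term of [decr], which tends to 0. *)
Lemma reference_steps yb sb lb : reference yb sb lb ->
  [/\ forall i, s i k.+1 - s i k @[k --> \oo] --> (0 : 'cV[R]_m),
      forall i, z i k.+1 - z i k @[k --> \oo] --> (0 : 'cV[R]_m) &
      forall i j, E i j -> y i k - y j k @[k --> \oo] --> (0 : 'cV[R]_m)].
Proof.
move=> /reference_decr[_ d0]; split=> [i|i|i j Eij].
- apply: cvg_shift2; apply: (dot_cvg0 D).
  apply: (@cvg0_dom _ _ _ _ _ _ (sigma) _ _ d0) => k; first exact: nsq_ge0.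
  rewrite -[X in _ <= X * _]invrK.
  apply: (le_inv_scaled (b := sigma * nsq (z i k.+2 - z i k.+1))).
  + by rewrite invr_gt0.
  + by rewrite mulr_ge0 ?nsq_ge0 // ltW.
  + apply: (energy_node (fn := fun i => decr_node i k.+1)) => [j|p].
      exact: decr_node_ge0.
    exact: decr_edge_ge0.
- apply: cvg_shift1; apply: (dot_cvg0 D).
  apply: (@cvg0_dom _ _ _ _ _ _ (sigma^-1) _ _ d0) => k; first exact: nsq_ge0.
  apply: (le_inv_scaled (b := sigma^-1 * nsq (s i k.+3 - s i k.+2))) => //.
  + by rewrite mulr_ge0 ?nsq_ge0 // invr_ge0 ltW.
  + rewrite addrC.
    apply: (energy_node (fn := fun i => decr_node i k.+1)) => [j|p].
      exact: decr_node_ge0.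
    exact: decr_edge_ge0.
- apply: cvg_shift2; apply: (dot_cvg0 D).
  apply: (@cvg0_dom _ _ _ _ _ _ ((rho / 2)^-1) _ _ d0) => k; first exact: nsq_ge0.
  apply: (le_inv_scaled (b := rho / 2 * nsq (y i k.+2 + y j k.+2 - (y i k.+1 + y j k.+1)))).
  + by rewrite divr_gt0.
  + by rewrite mulr_ge0 ?nsq_ge0 // divr_ge0 // ltW.
  + rewrite -mulrDr.
    apply: (energy_edge (fe := fun p => decr_edge p k.+1)) => // [l|p].
      exact: decr_node_ge0.
    exact: decr_edge_ge0.
Qed.

(** The limit at one node spreads along a path, edge by edge. *)
Lemma consensus (F : set_system nat) {FF : Filter F} (i0 : 'I_N)
    (yb : 'cV[R]_m) :
    (forall i j, connect E i j) ->
    (forall i j, E i j -> y i k - y j k @[k --> F] --> (0 : 'cV[R]_m)) ->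
    (forall i, y i k - z i k @[k --> F] --> (0 : 'cV[R]_m)) ->
    z i0 k @[k --> F] --> yb ->
  forall i, y i k @[k --> F] --> yb /\ z i k @[k --> F] --> yb.
Proof.
move=> E_conn yE yz z0 i.
have y0 : y i0 k @[k --> F] --> yb by exact: cvg_sub0 (yz i0) z0.
have yi : y i k @[k --> F] --> yb.
  have /connectP[p] := E_conn i0 i.
  elim: p i0 y0 {z0} => [|l p IH] j yj /=; first by move=> _ ->; exact: yj.
  move=> /andP[Ejl lp] iE.
  apply: (IH l _ lp iE); apply: (cvg_sub0 _ yj); apply: yE;
  by rewrite E_sym.
split=> //; apply: (cvg_sub0 _ yi).
under eq_fun do rewrite -opprB.
by rewrite -oppr0; apply: cvgN; exact: yz.
Qed.

(** In [a_step] everything but [lam] and [s] vanishes. The filter is arbitrary because this serves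
    along an ultrafilter first and along [\oo] afterwards. *)
Lemma a_cvg (F : set_system nat) {FF : Filter F} (sb : 'I_N -> 'cV[R]_m)
    (lb : 'I_N -> 'I_N -> 'cV[R]_m) i :
    (forall i, s i k.+1 - s i k @[k --> F] --> (0 : 'cV[R]_m)) ->
    (forall i, s i k.+2 - s i k.+1 @[k --> F] --> (0 : 'cV[R]_m)) ->
    (forall i, z i k.+1 - z i k @[k --> F] --> (0 : 'cV[R]_m)) ->
    (forall i, y i k.+1 - y i k @[k --> F] --> (0 : 'cV[R]_m)) ->
    (forall i j, E i j -> y i k - y j k @[k --> F] --> (0 : 'cV[R]_m)) ->
    (forall i j, E i j -> y i k.+1 - y j k.+1 @[k --> F] --> (0 : 'cV[R]_m)) ->
    (forall i, s i k @[k --> F] --> sb i) ->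
    (forall i j, E i j -> lam i j k @[k --> F] --> lb i j) ->
  a i k.+1 @[k --> F] --> rho *: (\sum_(j in nbrs E i) lb i j) + sb i.
Proof.
move=> ds ds1 dz dy yE yE1 sl ll; under eq_fun do rewrite a_step.
apply: cvgD; last first.
  rewrite -[X in _ --> X]addr0; apply: cvgD; last exact: cvgZ0.
  by apply: cvg_sub0 (ds1 i) _; apply: cvg_sub0 (ds i) _; exact: sl.
apply: cvgZl_tmp; apply: cvg_sum_seq => j; rewrite inE => Eij.
rewrite -[X in _ --> X]addr0; apply: cvgD.
  apply: (cvg_sub0 _ (ll _ _ Eij)).
  under eq_fun do rewrite lam_step addrAC subrr add0r.
  exact: yE.
by apply: cvgD0; [apply: cvgD0 => //; exact: yE1|].
Qed.

Theorem reference_convergence (i0 : 'I_N) :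
    (forall i j, connect E i j) ->
    (exists yb sb lb, reference yb sb lb) ->
  exists (yb : 'cV[R]_m) (sb : 'I_N -> 'cV[R]_m)
    (lb : 'I_N -> 'I_N -> 'cV[R]_m), [/\ forall i j, E i j -> lb j i = - lb i j,
    forall i, y i k @[k --> \oo] --> yb,
    forall i, z i k @[k --> \oo] --> yb,
    forall i, s i k @[k --> \oo] --> sb i &
    forall i, a i k.+1 @[k --> \oo] -->
       rho *: (\sum_(j in nbrs E i) lb i j) + sb i].
Proof.
move=> E_conn [y1 [s1 [l1 ref1]]].
have [ds dz yE] := reference_steps ref1.
have yz i : y i k - z i k @[k --> \oo] --> (0 : 'cV[R]_m).
  rewrite (_ : (fun k => _) = fun k => sigma^-1 *: (s i k.+1 - s i k)).
    exact: cvgZ0.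
  apply/funext => k; rewrite s_step addrAC subrr add0r scalerA.
  by rewrite mulVf ?scale1r // gt_eqF.
have shift (u : nat -> 'cV[R]_m) (l : 'cV[R]_m) :
  u k @[k --> \oo] --> l -> u k.+1 @[k --> \oo] --> l.
  by rewrite (cvg_shiftS u).
(* A step of [y] passes through [z]: to [z] at the old index, to [z] at the new one, then back to
   [y]. *)
have dy i : y i k.+1 - y i k @[k --> \oo] --> (0 : 'cV[R]_m).
  rewrite (_ : (fun k => _) = fun k =>
    ((y i k.+1 - z i k.+1) + (z i k.+1 - z i k)) + (-1) *: (y i k - z i k)).
    apply: cvgD0; last exact: cvgZ0.
    by apply: cvgD0 => //; apply: (shift (fun k => y i k - z i k)).
  by apply/funext => k; apply/colP => j; rewrite !mxE; lra.
have a_lim (F : set_system nat) (FF : Filter F) (sb : 'I_N -> 'cV[R]_m)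
    (lb : 'I_N -> 'I_N -> 'cV[R]_m) i : \oo `<=` F ->
    (forall i, s i k @[k --> F] --> sb i) ->
    (forall i j, E i j -> lam i j k @[k --> F] --> lb i j) ->
  a i k.+1 @[k --> F] --> rho *: (\sum_(j in nbrs E i) lb i j) + sb i.
  move=> ooF sl ll; apply: a_cvg => // [i'|i'|i'|i'|i' j' Eij|i' j' Eij];
    apply: (cvg_finer ooF) => //.
  - exact: (shift (fun k => s i' k.+1 - s i' k)).
  - exact: yE.
  - exact: (shift (fun k => y i' k - y j' k)) (yE _ _ Eij).
have [U [UU ooU]] := ultraFilterLemma (@eventually_filter).
have [lyap1 _] := reference_decr ref1.
pose M := lyap y1 s1 l1 1.
(* The bound [M] on the Lyapunov function is valid from index 1 on, hence the restriction to large
   [k]. *)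
have bounded (u : nat -> 'cV[R]_m) (l : 'cV[R]_m) c : 0 <= c ->
    (forall k, nsq (u k - l) <= c * lyap y1 s1 l1 k) ->
    exists l' : 'cV[R]_m, u k @[k --> U] --> l'.
  move=> c0 uM.
  have [|l' ul] := ultra_cvg_dot D (c * M) (u := fun k => u k - l) (U := U).
    apply: ooU; near=> k; apply: le_trans (uM k) _; rewrite ler_wpM2l //.
    have k0 : (0 < k)%N by near: k; exact: nbhs_infty_gt.
    by rewrite -(prednK k0); exact: lyap1.
  exists (l' + l); rewrite (_ : u = fun k => u k - l + l).
    by apply: cvgD => //; exact: cvg_cst.
  by apply/funext => k; rewrite subrK.
have [yb zyb] : exists yb : 'cV[R]_m, z i0 k @[k --> U] --> yb.
  apply: (bounded _ y1 sigma^-1) => [|k]; first by rewrite invr_ge0 ltW.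
  exact: lyap_z.
have /choice[sb ssb] i : exists l : 'cV[R]_m, s i k @[k --> U] --> l.
  have [|k|l sl] := bounded (fun k => s i k.+1) (s1 i) sigma; first exact: ltW.
    exact: lyap_s.
  exists l; apply: (cvg_sub0 _ sl); under eq_fun do rewrite -opprB.
  by rewrite -oppr0; apply: cvgN; exact: cvg_finer (ds i).
(* [lyap] controls [lam] on edges only; other pairs receive the value 0. *)
have /choice[lb lamlb] (p : 'I_N * 'I_N) : exists l : 'cV[R]_m, E p.1 p.2 ->
    lam p.1 p.2 k @[k --> U] --> l.
  have [Eij|_] := boolP (E p.1 p.2); last by exists 0.
  have [||l ll] := bounded (fun k => lam p.1 p.2 k.+1) (l1 p.1 p.2) (rho / 2)^-1.
  - by rewrite invr_ge0 divr_ge0 // ltW.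
  - by move=> k; exact: lyap_lam.
  exists l => _; apply: (cvg_sub0 _ ll); under eq_fun do rewrite -opprB.
  rewrite -oppr0; apply: cvgN.
  under eq_fun do rewrite lam_step addrAC subrr add0r.
  by apply: cvg_finer (yE _ _ Eij).
pose lb' i j := lb (i, j).
have lam_lb i j : E i j -> lam i j k @[k --> U] --> lb' i j.
  by move=> Eij; exact: (lamlb (i, j)).
have yzU : forall i, y i k @[k --> U] --> yb /\ z i k @[k --> U] --> yb.
  exact: (@consensus U _ i0 yb E_conn
  (fun i j Eij => cvg_finer ooU (yE i j Eij)) (fun i => cvg_finer ooU (yz i)) zyb).
have aU i := a_lim U _ sb lb' i ooU ssb lam_lb.
have y1U i : y i k.+1 @[k --> U] --> yb.
  by apply: (cvg_sub0 _ (yzU i).1); apply: cvg_finer (dy i).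
have z1U i : z i k.+1 @[k --> U] --> yb.
  by apply: (cvg_sub0 _ (yzU i).2); apply: cvg_finer (dz i).
have s1U i : s i k.+1 @[k --> U] --> sb i.
  by apply: (cvg_sub0 _ (ssb i)); apply: cvg_finer (ds i).
have s2U i : s i k.+2 @[k --> U] --> sb i.
  apply: (cvg_sub0 _ (s1U i)); apply: (cvg_finer ooU).
  exact: (shift (fun k => s i k.+1 - s i k)).
have lb_anti i j : E i j -> lb' j i = - lb' i j.
  move=> Eij; have Eji : E j i by rewrite E_sym.
  have h : lam j i k @[k --> U] --> - lb' i j.
    under eq_fun do rewrite (lam_anti i j).
    by apply: cvgN; exact: lam_lb.
  exact: (cvg_unique _ (lam_lb _ _ Eji) h).
(* The monotonicity inequalities between iterates [k] and [l] pass to the limit in [l] along [U]. *)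
have ref2 : reference yb sb lb'.
  split=> // i k.
    apply: (ler_cvg_to (a := U) (f := fun l =>
      D (y i k.+1 - y i l.+1) (a i k.+1 - a i l.+1)) _ (cvg_cst 0)).
      by apply: cvg_dot; apply: cvgB; (try exact: cvg_cst); [exact: y1U|exact: aU].
    by apply: nearW => l; exact: y_mono.
  apply: (ler_cvg_to (a := U) (g := fun l =>
      D (z i k.+1 - z i l.+1) (s i k.+2 - s i l.+2)) (cvg_cst 0)).
    by apply: cvg_dot; apply: cvgB; (try exact: cvg_cst); [exact: z1U|exact: s2U].
  by apply: nearW => l; exact: z_mono.
have [lyap2 _] := reference_decr ref2.
have nsq_cvg (u : nat -> 'cV[R]_m) (l : 'cV[R]_m) :
    u k @[k --> U] --> l -> nsq (u k - l) @[k --> U] --> (0 : R).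
  move=> ul; rewrite -(dot0l D 0) -(subrr l).
  by apply: cvg_dot; apply: cvgB => //; exact: cvg_cst.
have lyapU : lyap yb sb lb' k @[k --> U] --> (0 : R).
  apply: cvgD0_real.
    apply: cvg_sum_seq0 => i _.
    by apply: cvgD0_real; apply: cvgM0_real; apply: nsq_cvg;
      [exact: s1U|exact: (yzU i).2].
  apply: cvgM0_real; apply: cvg_sum_seq0 => p Ep; apply: cvgD0_real.
    apply: nsq_cvg; apply: (cvg_sub0 _ (lam_lb _ _ Ep)).
    under eq_fun do rewrite lam_step addrAC subrr add0r.
    exact: cvg_finer ooU (yE _ _ Ep).
  have yy : (y p.1 k - yb) + (y p.2 k - yb) @[k --> U] --> (0 : 'cV[R]_m).
    by apply: cvgD0; rewrite -(subrr yb); apply: cvgB;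
      (try exact: cvg_cst); exact: (yzU _).1.
  by rewrite -(dot0l D 0); exact: (cvg_dot D yy yy).
have lyap_oo : lyap yb sb lb' k @[k --> \oo] --> (0 : R).
  exact: ultra_nonincreasing_cvg0 ooU (lyap_ge0 _ _ _) lyap2 lyapU.
have z_oo i : z i k @[k --> \oo] --> yb.
  apply: (dot_cvgP D); apply: cvg0_dom lyap_oo => k; first exact: nsq_ge0.
  exact: lyap_z.
have s_oo i : s i k @[k --> \oo] --> sb i.
  apply: cvg_shift1; apply: (dot_cvgP D).
  by apply: cvg0_dom lyap_oo => k; [exact: nsq_ge0|exact: lyap_s].
have lam_oo i j : E i j -> lam i j k @[k --> \oo] --> lb' i j.
  move=> Eij; apply: cvg_shift1; apply: (dot_cvgP D).
  by apply: cvg0_dom lyap_oo => k; [exact: nsq_ge0|exact: lyap_lam].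
exists yb, sb, lb'; split=> // i.
- by apply: cvg_sub0 (yz i) (z_oo i).
- exact: a_lim.
Unshelve. all: by end_near. Qed.

End Lyapunov.

(** * Flows and duality *)

Section Flow.
Variables (R : realType) (m N : nat) (E : rel 'I_N).
Hypothesis E_sym : symmetric E.
Implicit Types (v : 'cV[R]_m) (u w : 'I_N).

Lemma sum_delta_nbrs v u w i : E u w ->
  \sum_(j in nbrs E i) ((i == u) && (j == w))%:R *: v = (i == u)%:R *: v.
Proof.
move=> Euw; have [->|iu] := eqVneq i u; last first.
  by rewrite /= scale0r big1 // => j _; rewrite scale0r.
rewrite (bigD1 w) ?inE //= eqxx big1 ?addr0 // => j /andP[_ /negPf ->].
by rewrite scale0r.
Qed.

(** The flow sends [v] along the path: each step adds one edge and its reverse with opposite sign,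
    and the contributions at the joining vertex cancel. *)
Lemma path_flow v (q : seq 'I_N) u : path E u q ->
  exists l : 'I_N -> 'I_N -> 'cV[R]_m, (forall i j, l j i = - l i j) /\
    forall i, \sum_(j in nbrs E i) l i j
              = (i == u)%:R *: v - (i == last u q)%:R *: v.
Proof.
elim: q u => [|w q IH] u /=.
  by exists (fun _ _ => 0); split=> [i j|i]; rewrite ?oppr0 // big1 // subrr.
move=> /andP[Euw /IH[l [l_anti l_div]]].
exists (fun i j => l i j + (((i == u) && (j == w))%:R *: v
                            - ((i == w) && (j == u))%:R *: v)); split.
  by move=> i j; rewrite l_anti opprD opprB andbC [(j == w) && _]andbC.
move=> i; rewrite big_split sumrB /= !sum_delta_nbrs //; last by rewrite E_sym.
by rewrite l_div addrC addrA subrK.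
Qed.

(** Each [c k] is routed along a path from [k] to the root [i0]; what accumulates at the root is the
    total, which is 0. *)
Lemma balanced_flow (c : 'I_N -> 'cV[R]_m) (i0 : 'I_N) :
    (forall i j, connect E i j) -> \sum_i c i = 0 ->
  exists l : 'I_N -> 'I_N -> 'cV[R]_m, (forall i j, l j i = - l i j) /\
    forall i, \sum_(j in nbrs E i) l i j = c i.
Proof.
move=> E_conn c0.
have /choice[l lP] k : exists l : 'I_N -> 'I_N -> 'cV[R]_m,
    (forall i j, l j i = - l i j) /\ forall i,
    \sum_(j in nbrs E i) l i j = (i == k)%:R *: c k - (i == i0)%:R *: c k.
  by have /connectP[q /(path_flow (c k)) + ->] := E_conn k i0.
exists (fun i j => \sum_k l k i j); split=> [i j|i].
  by rewrite -sumrN; apply: eq_bigr => k _; exact: (lP k).1.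
rewrite exchange_big /=; under eq_bigr => k _ do rewrite (lP k).2.
rewrite sumrB -scaler_sumr c0 scaler0 subr0 (bigD1 i) //= eqxx scale1r.
by rewrite big1 ?addr0 // => k /negPf; rewrite eq_sym => ->; rewrite scale0r.
Qed.

End Flow.

Section ErealSums.
Variable R : realType.
Local Open Scope ereal_scope.

Lemma esum_gtNy (I : finType) (f : I -> \bar R) :
  (forall i, -oo < f i) -> -oo < \sum_i f i.
Proof.
move=> f0; elim/big_ind: _ => //.
by move=> [x| |] [y| |] // _ _; rewrite ?ltNyr.
Qed.

Lemma esum_fin_numP (I : finType) (f : I -> \bar R) i :
  (forall i, -oo < f i) -> \sum_j f j < +oo -> f i \is a fin_num.
Proof.
move=> f0 fy; rewrite fin_numE gt_eqF //=.
apply/negP => /eqP fi; move: fy; rewrite lt_neqAle => /andP[+ _].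
rewrite esum_eqy => [|j _]; last by rewrite gt_eqF.
by move=> /negP; apply; apply/existsP; exists i; rewrite fi eqxx.
Qed.

End ErealSums.

(** * Conjugates and zero duality gap *)

Section Duality.
Variables (R : realType) (N m : nat) (n : 'I_N -> nat).
Variable dot : forall d : nat, {dot 'cV[R]_d for idfun}.
Variable f : forall i : 'I_N, 'cV[R]_(n i) -> \bar R.
Local Arguments f : clear implicits.
Hypothesis f_proper : forall i : 'I_N, proper_fun (f i).
Variables (A : forall i : 'I_N, 'M[R]_(m, n i)) (b : 'I_N -> 'cV[R]_m).
Variable K : set 'cV[R]_m.
Local Notation D := (dot m).

Definition residual (x : forall i, 'cV[R]_(n i)) :=
  \sum_(i < N) (A i *m x i - b i).

Local Notation conj i y :=
  (conjugate (dot (n i)) (f i) (- (adjoint D (dot (n i)) (A i) *m y))%R).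

(** A bound on the conjugate is an affine minorant of [f i]; moving the adjoint across the inner
    product makes it disappear. *)
Lemma conjugate_adjoint_le i y (c : R) :
  (conj i y <= c%:E)%E <-> forall u, ((- D y (A i *m u) - c)%:E <= f i u)%E.
Proof.
have dE u : dot (n i) (- (adjoint D (dot (n i)) (A i) *m y)) u
    = - D y (A i *m u).
  by rewrite dotNl dotC -adjointP dotC.
have conjE : (conj i y <= c%:E)%E <->
    forall u, ((- D y (A i *m u))%:E - f i u <= c%:E)%E.
  split=> [/ereal_supP h u|h].
    by apply: h; exists u => //; rewrite dE.
  by apply/ereal_supP => _ [u _ <-]; rewrite dE.
rewrite conjE; have fNy := (f_proper i).1.
split=> h u; have := h u; case: (f i u) (fNy u) => [r| |] // _;
  by rewrite ?leey ?leNye //= -?EFinB ?lee_fin => ?; lra.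
Qed.

Lemma conjugate_gtNy i y : (-oo < conj i y)%E.
Proof.
have [fNy [u fu]] := f_proper i.
apply: lt_le_trans (ereal_sup_ubound _); last by exists u.
by case: (f i u) (fNy u) fu => // r _ _; rewrite -EFinB ltNyr.
Qed.

Lemma indicator_gtNy (C : set 'cV[R]_m) y : (-oo < indicator C y)%E.
Proof. by rewrite /indicator; case: ifP. Qed.

(* Zero duality gap makes the Fenchel-Young inequalities of all nodes tight. *)
Lemma saddle_point (xs : 'cV[R]_(\sum_i n i)) (ys : 'cV[R]_m) (i0 : 'I_N) :
    is_minimizer (primal_feasible A b K) (primal_obj f) xs ->
    is_maximizer setT (dual_obj dot f A b K) ys ->
    primal_value f A b K = dual_value dot f A b K ->
  [/\ forall i, f i (submxcol xs i) \is a fin_num,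
      polar D K ys,
      D ys (residual (submxcol xs)) = 0,
      forall i u, (f i (submxcol xs i) <=
         f i u + (D ys (A i *m u - A i *m submxcol xs i))%:E)%E &
      dual_obj dot f A b K ys = primal_obj f xs].
Proof.
move=> [xs_feas xs_min] [_ ys_max] gap.
have dual_primal : dual_obj dot f A b K ys = primal_obj f xs.
  transitivity (dual_value dot f A b K).
    apply/eqP; rewrite eq_le; apply/andP; split.
      by apply: ereal_sup_ubound; exists ys.
    by apply/ereal_supP => _ [w _ <-]; exact: ys_max.
  rewrite -gap; apply/eqP; rewrite eq_le; apply/andP; split.
    by apply: ereal_inf_lbound; exists xs.
  by apply: le_ereal_inf_tmp => _ [w wf <-]; exact: xs_min.
pose T i := (conj i ys + (D ys (b i))%:E + indicator (polar D K) ys)%E.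
have TNy i : (-oo < T i)%E.
  have := conjugate_gtNy i ys; have := indicator_gtNy (polar D K) ys.
  rewrite /T; move: (conj i ys) (indicator (polar D K) ys).
  by move=> [q| |] [q'| |] // _ _; rewrite ltNyr.
have sumE : (- \sum_(i < N) T i = \sum_(i < N) f i (submxcol xs i))%E.
  exact: dual_primal.
have fNy i : (-oo < f i (submxcol xs i))%E by exact: (f_proper i).1.
(* Primal terms and dual terms [T i] all exceed [-oo] and their sums are opposite, so neither sum is
   [+oo] and every term is finite. *)
have f_fin i : f i (submxcol xs i) \is a fin_num.
  apply: (@esum_fin_numP _ _ (fun i => f i (submxcol xs i)) i) => //.
  rewrite -sumE -lteN2 oppeK; exact: esum_gtNy.
have T_fin i : T i \is a fin_num.
  apply: (@esum_fin_numP _ _ T i) => //; rewrite -lteN2 sumE; exact: esum_gtNy.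
have ys_polar : polar D K ys.
  have := T_fin i0; rewrite !fin_numD /indicator => /andP[_].
  by case: ifP => // /set_mem.
have indic0 : indicator (polar D K) ys = 0%E.
  by rewrite /indicator mem_set.
have conj_fin i : conj i ys \is a fin_num.
  by have := T_fin i; rewrite !fin_numD => /andP[/andP[]].
pose phi i := fine (f i (submxcol xs i)); pose c i := fine (conj i ys).
have phiE i : f i (submxcol xs i) = (phi i)%:E by rewrite fineK.
have cE i : conj i ys = (c i)%:E by rewrite fineK.
have real_sum : - \sum_(i < N) (c i + D ys (b i)) = \sum_(i < N) phi i.
  apply: EFin_inj; rewrite EFinN -!sumEFin.
  under [RHS]eq_bigr do rewrite -phiE.
  rewrite -sumE; congr (- _)%E; apply: eq_bigr => i _.
  by rewrite /T indic0 cE adde0.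
have c_le i u : ((- D ys (A i *m u) - c i)%:E <= f i u)%E.
  by move: u; apply/conjugate_adjoint_le; rewrite cE.
(* The Fenchel-Young gap of node [i]. Gaps are nonnegative, and primal feasibility with [ys] polar
   makes their sum nonpositive. *)
pose g i := c i + phi i + D ys (A i *m submxcol xs i).
have g_ge0 i : 0 <= g i.
  by have := c_le i (submxcol xs i); rewrite phiE lee_fin /g; lra.
have sum_g : \sum_(i < N) g i = D ys (residual (submxcol xs)).
  rewrite dot_sumr; under [RHS]eq_bigr do rewrite dotBr.
  rewrite sumrB /g !big_split /= -real_sum big_split /=; lra.
have res_le0 : D ys (residual (submxcol xs)) <= 0.
  by rewrite dotC; move/polarP: ys_polar; exact.
have sum_g0 : \sum_(i < N) g i = 0.
  by apply/eqP; rewrite eq_le sumr_ge0 // sum_g res_le0.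
split=> //; first by rewrite -sum_g.
move=> i u; have := psumr_eq0P (fun i _ => g_ge0 i) sum_g0 (i := i) isT.
rewrite /g phiE => gi0; have := c_le i u; rewrite dotBr.
case: (f i u) ((f_proper i).1 u) => [r| |] // _.
  by rewrite -EFinD !lee_fin; lra.
by move=> _; rewrite addye // leey.
Qed.

(* The bound on [f] is the limit of the subgradient inequalities at the
   iterates, in which [a i + b i] replaces the product [A i *m x i]. *)
Lemma dual_optimal (xs : 'cV[R]_(\sum_i n i)) (ys yb : 'cV[R]_m)
    (a : 'I_N -> 'cV[R]_m) :
    (forall i, f i (submxcol xs i) \is a fin_num) ->
    D ys (residual (submxcol xs)) = 0 -> polar D K yb ->
    D yb (\sum_i a i) = 0 -> D ys (\sum_i a i) <= 0 ->
    (forall i u, (f i (submxcol xs i)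
        - (D ys (a i + b i - A i *m submxcol xs i))%:E
      <= f i u + (D yb (A i *m u - (a i + b i)))%:E)%E) ->
  (primal_obj f xs <= dual_obj dot f A b K yb)%E.
Proof.
move=> f_fin ys0 yb_polar yb0 ys_le0 fa.
pose phi i := fine (f i (submxcol xs i)).
have phiE i : f i (submxcol xs i) = (phi i)%:E by rewrite fineK.
(* The constant obtained by reading [fa] as an affine minorant of [f i] with slope given by [yb]. *)
pose c i := - D yb (a i + b i) - phi i
            + D ys (a i + b i - A i *m submxcol xs i).
have conj_le i : (conj i yb <= (c i)%:E)%E.
  apply/conjugate_adjoint_le => u; have := fa i u; rewrite phiE /c dotBr.
  case: (f i u) ((f_proper i).1 u) => [r| |] // _;
    last by move=> _; rewrite leey.
  by rewrite -EFinB -EFinD !lee_fin; lra.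
rewrite /dual_obj leeNr.
apply: (@le_trans _ _ (\sum_(i < N) (c i + D yb (b i))%:E)%E).
  apply: lee_sum => i _; rewrite /indicator mem_set // adde0 EFinD.
  exact: leeD2r.
rewrite /primal_obj; under [in leRHS]eq_bigr do rewrite phiE.
rewrite !sumEFin -EFinN lee_fin.
have : \sum_(i < N) D yb (a i) = 0 by rewrite -dot_sumr.
have : \sum_(i < N) D ys (a i) <= 0 by rewrite -dot_sumr.
have : \sum_(i < N) (D ys (A i *m submxcol xs i) - D ys (b i)) = 0.
  by rewrite -[RHS]ys0 dot_sumr; apply: eq_bigr => i _; rewrite dotBr.
(* The first and last sums are 0 and the third is nonpositive, which leaves at most minus the primal
   value. *)
have -> : \sum_(i < N) (c i + D yb (b i)) = - \sum_(i < N) D yb (a i)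
  - \sum_(i < N) phi i + \sum_(i < N) D ys (a i)
  - \sum_(i < N) (D ys (A i *m submxcol xs i) - D ys (b i)).
  rewrite -!sumrN -!big_split /=; apply: eq_bigr => i _.
  by rewrite /c !dotE; lra.
lra.
Qed.

End Duality.

(** * The algorithm *)

(** In place of a subsequence: sets of [\oo] intersected with preimages of neighbourhoods of [l]
    generate a filter, proper because [l] is a cluster point. *)
Lemma cluster_filter (T : topologicalType) (u : nat -> T) (l : T) :
  cluster (u k @[k --> \oo]) l ->
  exists F : set_system nat,
    [/\ ProperFilter F, \oo `<=` F & u k @[k --> F] --> l].
Proof.
move=> ul.
pose B := [set AV : set nat * set T | \oo AV.1 /\ nbhs l AV.2].
exists (filter_from B (fun AV => AV.1 `&` u @^-1` AV.2)); split.
- apply: filter_from_proper => [|[A V] [/= ooA lV]].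
    apply: filter_from_filter => [|[A V] [A' V'] [/= ooA lV] [/= ooA' lV']].
      by exists (setT, setT); split; exact: filterT.
    exists (A `&` A', V `&` V'); first by split; exact: filterI.
    by move=> k [[Ak A'k] [Vk V'k]].
  have ooAV : (u k @[k --> \oo]) (u @` A) by apply: filterS ooA => k Ak; exists k.
  have [_ [[k Ak <-] Vk]] := ul _ _ ooAV lV.
  by exists k.
- move=> A ooA; exists (A, setT); first by split=> //; exact: filterT.
  by move=> k [].
- move=> V lV; exists (setT, V); first by split=> //; exact: filterT.
  by move=> k [].
Qed.

Lemma cvg_submxcol (R : realType) (N : nat) (n : 'I_N -> nat)
    (F : set_system nat) {FF : Filter F} (u : nat -> 'cV[R]_(\sum_i n i))
    (l : 'cV[R]_(\sum_i n i)) i :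
  u k @[k --> F] --> l -> submxcol (u k) i @[k --> F] --> submxcol l i.
Proof.
move=> ul; apply: cvg_cV => j; rewrite mxE.
under eq_fun do rewrite mxE; exact: cvg_coord.
Qed.

Section Algorithm.
Variables (R : realType) (N m : nat) (n : 'I_N -> nat).
Variable dot : forall d : nat, {dot 'cV[R]_d for idfun}.
Variable E : rel 'I_N.
Hypothesis E_undirected : symmetric E.
Hypothesis E_connected : forall i j : 'I_N, connect E i j.
Variable f : forall i : 'I_N, 'cV[R]_(n i) -> \bar R.
Local Arguments f : clear implicits.
Hypothesis f_convex : forall i : 'I_N, convex_efun (f i).
Hypothesis f_closed : forall i : 'I_N, closed_fun (f i).
Hypothesis f_proper : forall i : 'I_N, proper_fun (f i).
Variables (A : forall i : 'I_N, 'M[R]_(m, n i)) (b : 'I_N -> 'cV[R]_m).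
Variable K : set 'cV[R]_m.
Hypothesis K_nonempty : K !=set0.
Hypothesis K_closed : closed K.
Hypothesis K_convex : convex_set K.
Hypothesis K_cone : cone K.
Variables (sigma rho : R) (sigma_gt0 : 0 < sigma) (rho_gt0 : 0 < rho).
Variables (p s r y z : 'I_N -> nat -> 'cV[R]_m).
Variable x : forall i : 'I_N, nat -> 'cV[R]_(n i).
Local Arguments x : clear implicits.
Hypothesis p_init : forall i : 'I_N, p i 0%N = 0.
Hypothesis p_update : forall (k : nat) (i : 'I_N),
  p i k.+1 = p i k + rho *: \sum_(j in nbrs E i) (y i k - y j k).
Hypothesis s_update : forall (k : nat) (i : 'I_N),
  s i k.+1 = s i k + sigma *: (y i k - z i k).
Hypothesis r_update : forall (k : nat) (i : 'I_N),
  r i k.+1 = sigma *: z i k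
             + rho *: (\sum_(j in nbrs E i) (y i k + y j k))
             - (b i + p i k.+1 + s i k.+1).
Hypothesis x_update : forall (k : nat) (i : 'I_N),
  is_minimizer setT
    (fun u : 'cV[R]_(n i) =>
       (f i u
        + ((2 * (sigma + 2 * rho * (deg E i)%:R))^-1
           * ipnorm (dot m) (A i *m u + r i k.+1) ^+ 2)%:E)%E)
    (x i k.+1).
Hypothesis y_update : forall (k : nat) (i : 'I_N),
  y i k.+1 = (sigma + 2 * rho * (deg E i)%:R)^-1
             *: (A i *m x i k.+1 + r i k.+1).
Hypothesis z_update : forall (k : nat) (i : 'I_N),
  is_proj (dot m) (polar (dot m) K)
    (y i k.+1 + sigma^-1 *: s i k.+1) (z i k.+1).

Local Notation D := (dot m).

Lemma weight_gt0 i : 0 < sigma + 2 * rho * (deg E i)%:R.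
Proof. by rewrite ltr_wpDr // !mulr_ge0 // ltW. Qed.

(** By [y_update], [y i k.+1] is the gradient of the quadratic penalty with respect to [A i *m u] at
    the minimizer. *)
Lemma iterate_subgradient i k : f i (x i k.+1) \is a fin_num /\
  forall u, (f i (x i k.+1)
     <= f i u + (D (y i k.+1) (A i *m u - A i *m x i k.+1))%:E)%E.
Proof.
have := argmin_subgradient (weight_gt0 i) (@f_convex i) (f_proper i)
  (x_update k i).
by rewrite -y_update.
Qed.

(* [p i k / rho] is the divergence of the edge variables [lam]. *)
Definition lam (i j : 'I_N) (k : nat) : 'cV[R]_m :=
  \sum_(l < k) (y i l - y j l).

(** The zero initial value of [p] enters here: it makes [p] the divergence of an antisymmetric flow,
    so that its sum over the nodes vanishes. *)
Lemma p_lam i k : p i k = rho *: \sum_(j in nbrs E i) lam i j k.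
Proof.
elim: k => [|k IH].
  by rewrite p_init big1 ?scaler0 // => j _; rewrite /lam big_ord0.
rewrite p_update IH -scalerDr -big_split /=; congr (_ *: _).
by apply: eq_bigr => j _; rewrite /lam big_ord_recr.
Qed.

(** Eliminates [r] and [p]. Each neighbour takes a share [2 y i k.+1] of the degree term, and
    subtracting [y i k + y j k] leaves the three differences. *)
Lemma residual_step i k : A i *m x i k.+1 - b i =
  rho *: (\sum_(j in nbrs E i)
            (lam i j k.+1 + ((y i k.+1 - y j k.+1) + (y i k.+1 - y i k)
                             + (y j k.+1 - y j k))))
  + (s i k.+2 + sigma *: (z i k.+1 - z i k)).
Proof.
have -> : A i *m x i k.+1
    = (sigma + 2 * rho * (deg E i)%:R) *: y i k.+1 - r i k.+1.
  by rewrite y_update scalerA mulfV ?gt_eqF ?weight_gt0 // scale1r addrK.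
have -> : \sum_(j in nbrs E i)
    (lam i j k.+1 + ((y i k.+1 - y j k.+1) + (y i k.+1 - y i k)
                     + (y j k.+1 - y j k)))
  = \sum_(j in nbrs E i) lam i j k.+1 + (2 * (deg E i)%:R) *: y i k.+1
    - \sum_(j in nbrs E i) (y i k + y j k).
  have -> : (2 * (deg E i)%:R) *: y i k.+1
      = \sum_(j in nbrs E i) 2 *: y i k.+1.
    by rewrite sumr_const -/(deg E i) mulr_natr -scalerMnl.
  rewrite -big_split -sumrB; apply: eq_bigr => j _.
  by apply/colP => l; rewrite !mxE; lra.
rewrite r_update p_lam (s_update k.+1).
move: (\sum_(j in _) lam _ _ _) (\sum_(j in _) _) => u v.
by apply/colP => l; rewrite !mxE; lra.
Qed.

(** Add the subgradient inequalities of the two iterates, each tested at the other. *)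
Lemma y_monotone i k l :
  D (y i k.+1 - y i l.+1)
    ((A i *m x i k.+1 - b i) - (A i *m x i l.+1 - b i)) <= 0.
Proof.
have [fk /(_ (x i l.+1))] := iterate_subgradient i k.
have [fl /(_ (x i k.+1))] := iterate_subgradient i l.
rewrite -(fineK fk) -(fineK fl) -!EFinD !lee_fin !dotE; lra.
Qed.

Lemma z_polar i k : polar D K (z i k.+1).
Proof. exact: (z_update k i).1. Qed.

(** Moreau decomposition: up to [sigma], the multiplier is the residual of the projection. *)
Lemma s_projE i k :
  s i k.+2 = sigma *: (y i k.+1 + sigma^-1 *: s i k.+1 - z i k.+1).
Proof.
rewrite s_update !(scalerDr, scalerN) scalerA mulfV ?gt_eqF // scale1r.
by apply/colP => l; rewrite !mxE; lra.
Qed.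

Lemma s_orthogonal i k : D (z i k.+1) (s i k.+2) = 0.
Proof.
rewrite s_projE dotZr (proj_cone_orthogonal _ _ (z_update k i)) ?mulr0 //.
  exact: polar_segment.
by move=> t w t0; apply: polarZ; exact: ltW.
Qed.

Lemma s_normal i k w : polar D K w -> D w (s i k.+2) <= 0.
Proof.
move=> wK; have := proj_variational (@polar_segment _ _ D K) (z_update k i) wK.
rewrite dotBl -(pmulr_rle0 _ sigma_gt0) mulrBr -!dotZr -s_projE.
by rewrite s_orthogonal subr0.
Qed.

Lemma s_cone i k : K (s i k.+2).
Proof.
apply: (bipolar (D := D)) => //; first exact: convex_set_segment.
by move=> w wK; exact: s_normal.
Qed.

(** Diagonal products vanish by orthogonality, and the cross products are nonpositive since each [z]
    is polar. *)
Lemma z_monotone i k l :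
  0 <= D (z i k.+1 - z i l.+1) (s i k.+2 - s i l.+2).
Proof.
have := s_normal i k (z_polar i l); have := s_normal i l (z_polar i k).
by rewrite dotBl !dotBr !s_orthogonal; lra.
Qed.

(** The share [w / N] pairs nonpositively with the polar vectors [z] and to 0 with [ys], hence
    [ref_z]; [ref_y] adds the subgradient inequalities at [xs] and at the iterate. *)
Lemma saddle_reference (xs : forall i, 'cV[R]_(n i)) (ys : 'cV[R]_m) (i0 : 'I_N) :
    (forall i, f i (xs i) \is a fin_num) -> polar D K ys ->
    K (residual A b xs) -> D ys (residual A b xs) = 0 ->
    (forall i u, (f i (xs i) <= f i u + (D ys (A i *m u - A i *m xs i))%:E)%E) ->
  exists yb sb lb, reference D rho E y z s
    (fun i k => A i *m x i k - b i) yb sb lb.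
Proof.
move=> f_fin ys_polar wK ys0 fxs; set w := residual _ _ _ in wK ys0.
have N0 : N%:R != 0 :> R by rewrite pnatr_eq0 -lt0n (leq_trans _ (ltn_ord i0)).
(* The imbalance left by the equal split, divided by [rho] to offset the factor in front of the
   flow. *)
pose c i := rho^-1 *: (A i *m xs i - b i - N%:R^-1 *: w).
have c0 : \sum_i c i = 0.
  rewrite -scaler_sumr sumrB -/(residual A b xs) -/w sumr_const card_ord.
  by rewrite -scaler_nat scalerA mulfV // scale1r subrr scaler0.
have [lb [lb_anti lb_div]] := balanced_flow E_undirected i0 E_connected c0.
exists ys, (fun=> N%:R^-1 *: w), lb; split=> [i j _|i k|i k].
- exact: lb_anti.
- rewrite lb_div scalerA mulfV ?gt_eqF // scale1r subrK.
  have [fk /(_ (xs i))] := iterate_subgradient i k.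
  have := fxs i (x i k.+1).
  rewrite -(fineK fk) -(fineK (f_fin i)) -!EFinD !lee_fin !dotE; lra.
- have Ninv : 0 <= N%:R^-1 :> R by rewrite invr_ge0 ler0n.
  have zw : D (z i k.+1) w <= 0.
    by rewrite dotC; move/polarP: (z_polar i k); exact.
  rewrite dotBl !dotBr s_orthogonal !dotZr ys0 mulr0 subr0 sub0r.
  have := s_normal i k ys_polar; nra.
Qed.

Lemma algorithm_limit (i0 : 'I_N) :
    (exists yb sb lb, reference D rho E y z s
      (fun i k => A i *m x i k - b i) yb sb lb) ->
  exists (yb : 'cV[R]_m) (a : 'I_N -> 'cV[R]_m),
  [/\ forall i, y i k @[k --> \oo] --> yb /\ z i k @[k --> \oo] --> yb,
      forall i, A i *m x i k.+1 @[k --> \oo] --> a i + b i,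
      polar D K yb, D yb (\sum_i a i) = 0 & K (\sum_i a i)].
Proof.
move=> ref.
have lam_step i j k : lam i j k.+1 = lam i j k + (y i k - y j k).
  by rewrite /lam big_ord_recr.
have lam_anti i j k : lam j i k = - lam i j k.
  by rewrite /lam -sumrN; apply: eq_bigr => l _; rewrite opprB.
have [yb [sb [lb [lb_anti y_yb z_yb s_sb a_lim]]]] :=
  reference_convergence sigma_gt0 rho_gt0 E_undirected lam_step lam_anti
    (fun i k => s_update k i) residual_step y_monotone z_monotone
    i0 E_connected ref.
have z1 i : z i k.+1 @[k --> \oo] --> yb by rewrite (cvg_shiftS (z i)).
have s2 i : s i k.+2 @[k --> \oo] --> sb i.
  by rewrite (cvg_shiftS (fun k => s i k.+1)) (cvg_shiftS (s i)).
have sbK i : K (sb i).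
  by apply: (closed_cvg _ K_closed _ _ (s2 i)); apply: nearW => k; exact: s_cone.
have yb_polar : polar D K yb.
  apply/polarP => u Ku.
  apply: (ler_cvg_to (cvg_dot D (cvg_cst u) (z1 i0)) (cvg_cst 0)).
  by apply: nearW => k; move/polarP: (z_polar i0 k); exact.
have yb_sb i : D yb (sb i) = 0.
  have h : D (z i k.+1) (s i k.+2) @[k --> \oo] --> D yb (sb i).
    exact: cvg_dot.
  have h0 : D (z i k.+1) (s i k.+2) @[k --> \oo] --> (0 : R).
    by under eq_fun do rewrite s_orthogonal; exact: cvg_cst.
  exact: (cvg_unique _ h h0).
(* The flow cancels in the sum over the nodes, leaving elements of [K] orthogonal to [yb]. *)
pose a i := rho *: (\sum_(j in nbrs E i) lb i j) + sb i.
have suma : \sum_i a i = \sum_i sb i.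
  by rewrite big_split /= -scaler_sumr sum_antisymmetric // scaler0 add0r.
exists yb, a; split=> // [i||].
- rewrite (_ : (fun k => _) = fun k => A i *m x i k.+1 - b i + b i).
    by apply: cvgD; [exact: a_lim|exact: cvg_cst].
  by apply/funext => k; rewrite subrK.
- by rewrite suma dot_sumr big1.
- by rewrite suma; apply: (cone_sum D) => //; exact: convex_set_segment.
Qed.

(** The inequality at [xs] tested at the iterate, added to that of the iterate tested at [u],
    eliminates [f i (x i k.+1)]; only [y] and [A i *m x i] remain, and these converge. *)
Lemma limit_dual_optimal (xs : 'cV[R]_(\sum_i n i)) (ys yb : 'cV[R]_m)
    (a : 'I_N -> 'cV[R]_m) :
    (forall i, f i (submxcol xs i) \is a fin_num) -> polar D K ys ->
    D ys (residual A b (submxcol xs)) = 0 ->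
    (forall i u, (f i (submxcol xs i)
        <= f i u + (D ys (A i *m u - A i *m submxcol xs i))%:E)%E) ->
    (forall i, y i k @[k --> \oo] --> yb) ->
    (forall i, A i *m x i k.+1 @[k --> \oo] --> a i + b i) ->
    polar D K yb -> D yb (\sum_i a i) = 0 -> K (\sum_i a i) ->
  (primal_obj f xs <= dual_obj dot f A b K yb)%E.
Proof.
move=> f_fin /polarP ys_polar ys0 fxs y_yb Ax_a yb_polar yb0 aK.
apply: (dual_optimal f_proper f_fin ys0 yb_polar yb0).
  by rewrite dotC; exact: ys_polar.
move=> i u; have := (f_proper i).1 u.
case fu : (f i u) => [v| |] // _; last by rewrite addye // leey.
rewrite -(fineK (f_fin i)) -EFinB -EFinD lee_fin.
have y1 : y i k.+1 @[k --> \oo] --> yb by rewrite (cvg_shiftS (y i)).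
have lhs : fine (f i (submxcol xs i))
    - D ys (A i *m x i k.+1 - A i *m submxcol xs i) @[k --> \oo] -->
    fine (f i (submxcol xs i)) - D ys (a i + b i - A i *m submxcol xs i).
  apply: cvgB; first exact: cvg_cst.
  by apply: cvg_dot; [exact: cvg_cst|apply: cvgB => //; exact: cvg_cst].
have rhs : v + D (y i k.+1) (A i *m u - A i *m x i k.+1) @[k --> \oo] -->
    v + D yb (A i *m u - (a i + b i)).
  apply: cvgD; first exact: cvg_cst.
  by apply: cvg_dot => //; apply: cvgB => //; exact: cvg_cst.
apply: (ler_cvg_to lhs rhs); apply: nearW => k.
have [fk /(_ u)] := iterate_subgradient i k.
have := fxs i (x i k.+1); rewrite fu -(fineK fk) -(fineK (f_fin i)).
by rewrite -!EFinD !lee_fin; lra.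
Qed.

(** Closed epigraphs carry the subgradient bounds, tested at [xs], to the limit point;
    complementarity of [yb] and feasibility of [xs] make these bounds sum to at most the optimal
    value. *)
Lemma limit_primal_optimal (xs : 'cV[R]_(\sum_i n i)) (yb : 'cV[R]_m)
    (a : 'I_N -> 'cV[R]_m) xbar :
    is_minimizer (primal_feasible A b K) (primal_obj f) xs ->
    (forall i, f i (submxcol xs i) \is a fin_num) ->
    (forall i, y i k @[k --> \oo] --> yb) ->
    (forall i, A i *m x i k.+1 @[k --> \oo] --> a i + b i) ->
    polar D K yb -> D yb (\sum_i a i) = 0 -> K (\sum_i a i) ->
    cluster ((\mxcol_(i < N) x i k) @[k --> \oo]) xbar ->
  is_minimizer (primal_feasible A b K) (primal_obj f) xbar.
Proof.
move=> [xs_feas xs_min] f_fin y_yb Ax_a yb_polar yb0 aK.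
move=> /cluster_filter[F [FP ooF xF]].
have x_lim i : x i k @[k --> F] --> submxcol xbar i.
  have : submxcol (\mxcol_i x i k) i @[k --> F] --> submxcol xbar i.
    exact: cvg_submxcol.
  by under eq_fun do rewrite mxcolK.
have Ax i : A i *m x i k @[k --> \oo] --> a i + b i.
  by rewrite -(cvg_shiftS (fun k => A i *m x i k)); exact: Ax_a.
have Axbar i : A i *m submxcol xbar i = a i + b i.
  have AxF : A i *m x i k @[k --> F] --> A i *m submxcol xbar i.
    exact: cvg_mulmxl.
  exact: (cvg_unique _ AxF (cvg_finer ooF (Ax i))).
have resE : \sum_(i < N) (A i *m submxcol xbar i - b i) = \sum_i a i.
  by apply: eq_bigr => i _; rewrite Axbar addrK.
pose t i := fine (f i (submxcol xs i))
            + D yb (A i *m submxcol xs i - A i *m submxcol xbar i).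
have f_le i : (f i (submxcol xbar i) <= (t i)%:E)%E.
  pose tk k := fine (f i (submxcol xs i))
            + D (y i k) (A i *m submxcol xs i - A i *m x i k).
  have tF : tk k @[k --> F] --> t i.
    apply: cvgD; first exact: cvg_cst.
    apply: cvg_dot; first exact: cvg_finer ooF (y_yb i).
    by apply: cvgB; [exact: cvg_cst|exact: cvg_mulmxl].
  have pairF : (x i k, tk k) @[k --> F] --> (submxcol xbar i, t i).
    exact: cvg_pair (x_lim i) tF.
  apply: (closed_cvg _ (@f_closed i) _ _ pairF).
  (* [x i 0] is arbitrary, so the subgradient bound is used at positive indices. *)
  apply: (ooF); near=> k.
  have k0 : (0 < k)%N by near: k; exact: nbhs_infty_gt.
  have [_ /(_ (submxcol xs i))] := iterate_subgradient i k.-1.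
  by rewrite prednK //= /tk EFinD fineK.
split; first by rewrite /primal_feasible /= resE.
move=> w wf; apply: le_trans (xs_min w wf).
apply: (@le_trans _ _ (\sum_(i < N) (t i)%:E)%E); first exact: lee_sum.
rewrite /primal_obj sumEFin; under [in leRHS]eq_bigr do rewrite -(fineK (f_fin _)).
rewrite sumEFin lee_fin big_split /= gerDl -dot_sumr.
have -> : \sum_(i < N) (A i *m submxcol xs i - A i *m submxcol xbar i)
    = \sum_(i < N) (A i *m submxcol xs i - b i)
      - \sum_(i < N) (A i *m submxcol xbar i - b i).
  by rewrite -sumrB; apply: eq_bigr => i _; rewrite opprB addrA subrK.
rewrite resE dotBr yb0 subr0 dotC; move/polarP: yb_polar; exact.
Unshelve. all: by end_near. Qed.

End Algorithm.


Theorem proposition2 (R : realType) (N m : nat) (n : 'I_N -> nat)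
    (dot : forall d : nat, {dot 'cV[R]_d for idfun})
    (E : rel 'I_N)
    (E_undirected : symmetric E)
    (E_connected : forall i j : 'I_N, connect E i j)
    (f : forall i : 'I_N, 'cV[R]_(n i) -> \bar R)
    (f_convex : forall i : 'I_N, convex_efun (f i))
    (f_closed : forall i : 'I_N, closed_fun (f i))
    (f_proper : forall i : 'I_N, proper_fun (f i))
    (A : forall i : 'I_N, 'M[R]_(m, n i)) (b : 'I_N -> 'cV[R]_m)
    (K : set 'cV[R]_m)
    (K_nonempty : K !=set0) (K_closed : closed K)
    (K_convex : convex_set K) (K_cone : cone K)
    (primal_solution : exists x, is_minimizer (primal_feasible A b K) (primal_obj f) x)
    (dual_solution : exists y, is_maximizer setT (dual_obj dot f A b K) y)
    (zero_gap : primal_value f A b K = dual_value dot f A b K)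
    (sigma rho : R) (sigma_gt0 : 0 < sigma) (rho_gt0 : 0 < rho)
    (p s r y z : 'I_N -> nat -> 'cV[R]_m)
    (x : forall i : 'I_N, nat -> 'cV[R]_(n i))
    (p_init : forall i : 'I_N, p i 0%N = 0)
    (p_update : forall (k : nat) (i : 'I_N),
       p i k.+1 = p i k + rho *: \sum_(j in nbrs E i) (y i k - y j k))
    (s_update : forall (k : nat) (i : 'I_N),
       s i k.+1 = s i k + sigma *: (y i k - z i k))
    (r_update : forall (k : nat) (i : 'I_N),
       r i k.+1 = sigma *: z i k
                  + rho *: (\sum_(j in nbrs E i) (y i k + y j k))
                  - (b i + p i k.+1 + s i k.+1))
    (x_update : forall (k : nat) (i : 'I_N),
       is_minimizer setT
         (fun u : 'cV[R]_(n i) =>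
            (f i u
             + ((2 * (sigma + 2 * rho * (deg E i)%:R))^-1
                * ipnorm (dot m) (A i *m u + r i k.+1) ^+ 2)%:E)%E)
         (x i k.+1))
    (y_update : forall (k : nat) (i : 'I_N),
       y i k.+1 = (sigma + 2 * rho * (deg E i)%:R)^-1
                  *: (A i *m x i k.+1 + r i k.+1))
    (z_update : forall (k : nat) (i : 'I_N),
       is_proj (dot m) (polar (dot m) K)
         (y i k.+1 + sigma^-1 *: s i k.+1) (z i k.+1)) :
  (exists ystar : 'cV[R]_m,
     is_maximizer setT (dual_obj dot f A b K) ystar /\
     forall i : 'I_N,
       (y i k @[k --> \oo] --> ystar) /\ (z i k @[k --> \oo] --> ystar)) /\
  (forall xbar : 'cV[R]_(\sum_i n i),
     cluster ((\mxcol_(i < N) x i k) @[k --> \oo]) xbar ->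
     is_minimizer (primal_feasible A b K) (primal_obj f) xbar).
Proof.
have [xs xs_min] := primal_solution; have [ys ys_max] := dual_solution.
(* The general argument picks a node [i0]. Without nodes all sums are empty, and [cone_sum] puts 0
   in [K]. *)
have [[i0 _]|N0] := pselect (exists i : 'I_N, True); last first.
  have absurd (i : 'I_N) : False by apply: N0; exists i.
  split=> [|xbar _]; first by exists ys; split=> // i; case: (absurd i).
  split=> [|w _].
    by apply: (cone_sum (dot m)) => //; exact: convex_set_segment.
  by rewrite /primal_obj !big1 // => i; case: (absurd i).
have [f_fin ys_polar ys0 fxs dual_primal] :=
  saddle_point f_proper i0 xs_min ys_max zero_gap.
have ref := saddle_reference E_undirected E_connected f_convex f_proper
  sigma_gt0 rho_gt0 s_update x_update
  y_update z_update i0 f_fin ys_polar xs_min.1 ys0 fxs.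
have [yb [a [yz_yb Ax_a yb_polar yb0 aK]]] :=
  algorithm_limit E_undirected E_connected f_convex f_proper
  K_nonempty K_closed K_convex K_cone sigma_gt0 rho_gt0 p_init p_update s_update
  r_update x_update y_update z_update i0 ref.
have y_yb i : y i k @[k --> \oo] --> yb by exact: (yz_yb i).1.
split=> [|xbar xbar_cluster].
  (* Every dual value is at most that of [ys], which equals the primal optimum, itself at most the
     dual value at [yb]. *)
  exists yb; split=> //; split=> // w _; apply: le_trans (ys_max.2 w I) _.
  rewrite dual_primal.
  exact: (limit_dual_optimal f_convex f_proper sigma_gt0 rho_gt0 x_update
    y_update f_fin ys_polar ys0 fxs y_yb Ax_a yb_polar yb0 aK).
exact: (limit_primal_optimal f_convex f_closed f_proper sigma_gt0 rho_gt0
  x_update y_update xs_min f_fin y_yb Ax_a yb_polar yb0 aK xbar_cluster).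
Qed.
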